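(* Let $V:\mathbb{R}\to\mathbb{R}$ be measurable with $V(x)\to\infty$ as $|x|\to\infty$ and $V\in L^2(\mathbb{R},e^{-x^2}dx)$, and write $V=\sum_{j=0}^\infty v_jH_j$ (convergence in $L^2(\mathbb{R},e^{-x^2}dx)$), where $H_j$ is the $j$-th physicists' Hermite polynomial, i.e. $v_j=\frac{1}{\sqrt\pi\,2^jj!}\int_{\mathbb{R}}V(x)H_j(x)e^{-x^2}dx$. Let $\lambda_0<\lambda_1\le\cdots$ be the eigenvalues of the Schr\''odinger operator $-\frac{d^2}{dx^2}+V$ on $L^2(\mathbb{R})$. Then for every $n\in\mathbb{N}=\{0,1,2,\dots\}$, \[ \sum_{k=0}^n\lambda_k\le\sum_{k=0}^n\frac{2^k(2k)!}{k!}\binom{n+1}{k+1}v_{2k}+\frac12(n+1)^2. \]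
   Context: The physicists' Hermite polynomials satisfy $H_0=1$, $H_1(x)=2x$, $H_{n+1}(x)=2xH_n(x)-2nH_{n-1}(x)$, and $\int_{\mathbb{R}}e^{-x^2}H_nH_m\,dx=\delta_{nm}\sqrt\pi\,2^nn!$. The condition $V\to\infty$ ensures the spectrum is discrete; eigenvalues are listed in non-decreasing order with multiplicity. *)

(* Defs.v *)
From HB Require Import structures.
From mathcomp Require Import all_boot all_order all_algebra.
From mathcomp Require Import all_classical all_reals all_analysis.
Set Implicit Arguments. Unset Strict Implicit. Unset Printing Implicit Defensive.
Import Order.TTheory GRing.Theory Num.Theory.
Import numFieldNormedType.Exports.
Local Open Scope classical_set_scope.
Local Open Scope ring_scope.

(* The measurable space R equipped with the Lebesgue sigma-algebra
   (completion of the Borel sigma-algebra) and the (completed)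
   Lebesgue measure. *)
Notation LebR R := (caratheodory_type (@wlength R idfun)^*%mu).
Notation leb R := (@completed_lebesgue_measure R).

Definition leb_measurable (R : realType) (f : R -> R) : Prop :=
  measurable_fun (setT : set (LebR R)) (f : LebR R -> R).

Definition leb_integrable (R : realType) (f : R -> R) : Prop :=
  (leb R).-integrable (setT : set (LebR R)) (fun x : LebR R => (f x)%:E).

Definition lint (R : realType) (f : R -> R) : R :=
  Rintegral (leb R) (setT : set (LebR R)) (f : LebR R -> R).
Definition lint_on (R : realType) (A : set R) (f : R -> R) : R :=
  Rintegral (leb R) (A : set (LebR R)) (f : LebR R -> R).

Definition L2 (R : realType) (f : R -> R) : Prop :=
  leb_measurable f /\ leb_integrable (fun x => f x ^+ 2).

(* Physicists' Hermite polynomials, H_0 = 1, H_1 = 2x,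
   H_{n+1} = 2x H_n - 2n H_{n-1}; hermite_pair n x = (H_n x, H_{n+1} x). *)
Fixpoint hermite_pair (R : realType) (n : nat) (x : R) : R * R :=
  match n with
  | O => (1, 2 * x)
  | S m => let p := hermite_pair m x in
           (p.2, 2 * x * p.2 - 2 * (m.+1)%:R * p.1)
  end.
Definition hermite (R : realType) (n : nat) (x : R) : R := (hermite_pair n x).1.

Definition hermite_coef (R : realType) (V : R -> R) (j : nat) : R :=
  (Num.sqrt pi * 2 ^+ j * (j`!)%:R)^-1 *
  lint (fun x => V x * hermite j x * expR (- x ^+ 2)).

Definition test_fun (R : realType) (phi : R -> R) : Prop :=
  (forall x, derivable phi x 1) /\ continuous (derive1 phi) /\
  exists M : R, forall x, M < `|x| -> phi x = 0.

(* psi is in H^1(R) with weak derivative g (g in L^2, psi is the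
   absolutely continuous primitive of g). *)
Definition weak_deriv (R : realType) (psi g : R -> R) : Prop :=
  L2 psi /\ L2 g /\
  forall a b : R, a <= b -> psi b - psi a = lint_on `[a, b] g.

(* psi is an eigenfunction of the Schroedinger operator -d^2/dx^2 + V
   (defined through its closed quadratic form) with eigenvalue lam:
   psi is in the form domain (H^1 with int |V| psi^2 < oo) and
   -psi'' + V psi = lam psi holds weakly. *)
Definition schrodinger_eigenfun (R : realType) (V : R -> R) (lam : R)
    (psi : R -> R) : Prop :=
  exists g : R -> R,
    weak_deriv psi g /\
    leb_integrable (fun x => `|V x| * psi x ^+ 2) /\
    forall phi : R -> R, test_fun phi ->
      lint (fun x => g x * derive1 phi x) + lint (fun x => V x * psi x * phi x)
      = lam * lint (fun x => psi x * phi x).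

(* lam : nat -> R is the sequence of eigenvalues of -d^2/dx^2 + V listed in
   non-decreasing order with multiplicity: there is a complete orthonormal
   family (an orthonormal basis of L^2(R)) of eigenfunctions psi k with
   eigenvalues lam k. *)
Definition schrodinger_eigenvalues (R : realType) (V : R -> R)
    (lam : nat -> R) : Prop :=
  (forall k, lam k <= lam k.+1) /\
  exists psi : nat -> R -> R,
    (forall k, L2 (psi k) /\ schrodinger_eigenfun V (lam k) (psi k)) /\
    (forall i j, lint (fun x => psi i x * psi j x) = (i == j)%:R) /\
    (forall f : R -> R, L2 f ->
       (forall k, lint (fun x => f x * psi k x) = 0) ->
       {ae leb R, forall x : LebR R, f x = 0}).

(* Main.v *)
(** The normalised Hermite functions [h_j = H_j e^(-x^2/2)] are orthonormal, and
    the sum of their energies [\int h_j'^2 + V h_j^2] over [j <= n] is the right-hand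
    side: the kinetic part is [j + 1/2], and linearizing [H_j^2] in the [H_2k]
    evaluates the potential part in terms of the [v_2k].

    The [h_j] need not lie in the domain of the operator, so they are truncated to
    [phi_j = chi h_j] with a C^2 compactly supported cutoff [0 <= chi <= 1].  Then
    [T phi_j := - phi_j'' + V phi_j] is in L^2 because V is locally L^2, and the weak
    eigenvalue equation gives [<T phi_j, psi_k> = lam_k <phi_j, psi_k>], whence by
    Parseval [\sum_j <T phi_j, phi_j> = \sum_k lam_k w_k] with
    [w_k = \sum_j <phi_j, psi_k>^2].  Bessel's inequality for [chi psi_k] against
    the [h_j] yields [w_k <= 1], which bounds this sum below by the lowest
    eigenvalues up to the defect [n + 1 - \sum_j |phi_j|^2]; finally [chi -> 1]. *)
Require Import Defs.
From HB Require Import structures.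
From mathcomp Require Import all_boot all_order all_algebra.
From mathcomp Require Import all_classical all_reals all_analysis.
From mathcomp Require Import measurable_realfun gauss_integral.
From mathcomp Require Import ring lra zify.
Import Order.TTheory GRing.Theory Num.Theory.
Import numFieldNormedType.Exports.
Local Open Scope classical_set_scope.
Local Open Scope ring_scope.
Set Implicit Arguments. Unset Strict Implicit. Unset Printing Implicit Defensive.

(** * Square-integrable functions and Parseval *)

Section SquareIntegrable.
Context d (T : measurableType d) (R : realType) (mu : {measure set T -> \bar R}).
Implicit Types f g h : T -> R.

Definition Rintegrable f := mu.-integrable setT (EFin \o f).

Definition sqint f := measurable_fun setT f /\ Rintegrable (fun x => f x ^+ 2).

Definition ip f g := \int[mu]_x (f x * g x).

Lemma RintegrableD f g : Rintegrable f -> Rintegrable g ->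
  Rintegrable (fun x => f x + g x).
Proof. by move=> fi gi; exact: (integrableD _ fi gi). Qed.

Lemma RintegrableZ (c : R) f : Rintegrable f -> Rintegrable (fun x => c * f x).
Proof. by move=> fi; exact: (integrableZl _ c fi). Qed.

Lemma Rintegrable_sum I (s : seq I) (P : pred I) (f : I -> T -> R) :
  (forall i, P i -> Rintegrable (f i)) ->
  Rintegrable (fun x => \sum_(i <- s | P i) f i x).
Proof.
move=> fi; have := integrable_sum measurableT s fi.
apply: eq_integrable => // x _ /=; rewrite -sumEFin.
by [].
Qed.

Lemma Rintegrable_le f g : measurable_fun setT f -> Rintegrable g ->
  (forall x, `|f x| <= g x) -> Rintegrable f.
Proof.
move=> mf gi fg; apply: (le_integrable measurableT _ _ gi).
  exact/measurable_EFinP.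
by move=> x _ /=; rewrite lee_fin (le_trans (fg x))// ler_norm.
Qed.

Lemma Rintegral_sum I (s : seq I) (P : pred I) (f : I -> T -> R) :
  (forall i, P i -> Rintegrable (f i)) ->
  \int[mu]_x (\sum_(i <- s | P i) f i x) = \sum_(i <- s | P i) \int[mu]_x f i x.
Proof.
move=> fi; elim: s => [|i s IH].
  under eq_Rintegral do rewrite big_nil.
  by rewrite big_nil Rintegral_cst// mul0r.
rewrite big_cons -IH; under eq_Rintegral do rewrite big_cons.
case: ifP => // Pi.
by rewrite RintegralD//; [exact: fi|exact: Rintegrable_sum].
Qed.

Lemma sqint_measurable f : sqint f -> measurable_fun setT f.
Proof. by case. Qed.

Lemma ipC f g : ip f g = ip g f.
Proof. by apply: eq_Rintegral => x _; rewrite mulrC. Qed.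

Lemma ip_ge0 f : 0 <= ip f f.
Proof. by apply: Rintegral_ge0 => x _; rewrite -expr2 sqr_ge0. Qed.

Lemma sqint_mul f g : sqint f -> sqint g -> Rintegrable (fun x => f x * g x).
Proof.
move=> [mf f2] [mg g2]; apply: (Rintegrable_le _ (RintegrableD f2 g2)).
  exact: measurable_funM.
move=> x; rewrite ler_norml; apply/andP; split; nra.
Qed.

Lemma sqintZ (c : R) f : sqint f -> sqint (fun x => c * f x).
Proof.
move=> [mf f2]; split; first exact: measurable_funM.
under eq_fun do rewrite exprMn.
exact: RintegrableZ.
Qed.

Lemma sqintD f g : sqint f -> sqint g -> sqint (fun x => f x + g x).
Proof.
move=> sf sg; split; first exact: measurable_funD sf.1 sg.1.
have -> : (fun x => (f x + g x) ^+ 2) =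
          (fun x => (f x ^+ 2 + g x ^+ 2) + 2 * (f x * g x)).
  by apply/funext => x; ring.
apply: RintegrableD; first exact: RintegrableD sf.2 sg.2.
exact/RintegrableZ/sqint_mul.
Qed.

Lemma sqintB f g : sqint f -> sqint g -> sqint (fun x => f x - g x).
Proof.
move=> sf /(sqintZ (-1)) sg; have := sqintD sf sg.
by under eq_fun do rewrite mulN1r.
Qed.

Lemma sqint_sum I (s : seq I) (P : pred I) (f : I -> T -> R) :
  (forall i, P i -> sqint (f i)) -> sqint (fun x => \sum_(i <- s | P i) f i x).
Proof.
move=> sf; elim: s => [|i s IH].
  have -> : (fun x : T => \sum_(i <- [::] | P i) f i x) = cst 0.
    by apply/funext => x; rewrite big_nil.
  split; first exact: measurable_cst.
  by under eq_fun do rewrite expr0n/=; exact: integrable0.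
have [Pi|Pi] := boolP (P i); last by under eq_fun do rewrite big_cons (negbTE Pi).
under eq_fun do rewrite big_cons Pi.
by apply: sqintD => //; exact: sf.
Qed.

Lemma sqint_le f g : measurable_fun setT f -> sqint g ->
  (forall x, `|f x| <= `|g x|) -> sqint f.
Proof.
move=> mf sg fg; split => //.
apply: (Rintegrable_le _ sg.2); first exact: measurable_funX.
move=> x; rewrite normrX -[leRHS]ger0_norm ?sqr_ge0// normrX.
by rewrite lerXn2r ?nnegrE.
Qed.

Lemma ipZr (c : R) f g : sqint f -> sqint g ->
  ip f (fun x => c * g x) = c * ip f g.
Proof.
move=> sf sg; rewrite /ip; under eq_Rintegral do rewrite mulrCA.
by rewrite RintegralZl//; exact: sqint_mul.
Qed.

Lemma ipBr f g h : sqint f -> sqint g -> sqint h ->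
  ip f (fun x => g x - h x) = ip f g - ip f h.
Proof.
move=> sf sg sh; rewrite /ip; under eq_Rintegral do rewrite mulrBr.
by rewrite RintegralB//; exact: sqint_mul.
Qed.

Lemma ip_sumr I (s : seq I) (P : pred I) f (g : I -> T -> R) :
  sqint f -> (forall i, P i -> sqint (g i)) ->
  ip f (fun x => \sum_(i <- s | P i) g i x) = \sum_(i <- s | P i) ip f (g i).
Proof.
move=> sf sg; rewrite /ip; under eq_Rintegral do rewrite mulr_sumr.
by rewrite Rintegral_sum// => i Pi; apply: sqint_mul => //; exact: sg.
Qed.

Lemma ip_sqrB f g : sqint f -> sqint g ->
  ip (fun x => f x - g x) (fun x => f x - g x) = ip f f - 2 * ip f g + ip g g.
Proof.
move=> sf sg; have sfg := sqintB sf sg.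
rewrite ipBr// (ipC _ f) (ipC _ g) !ipBr// (ipC g f); ring.
Qed.

Lemma cauchy_schwarz f g : sqint f -> sqint g -> ip f g ^+ 2 <= ip f f * ip g g.
Proof.
move=> sf sg.
have q (t : R) : 0 <= ip f f - 2 * (t * ip f g) + t ^+ 2 * ip g g.
  have := ip_ge0 (fun x => f x - t * g x).
  have stg := sqintZ t sg.
  rewrite ip_sqrB// (ipZr t sf sg) (ipZr t stg sg) (ipC (fun x => t * g x))
    (ipZr t sg sg).
  by rewrite expr2 !mulrA.
have [g0|g0] := eqVneq (ip g g) 0.
  have [->|fg0] := eqVneq (ip f g) 0; first by rewrite g0 mulr0 expr0n.
  have := q ((ip f f + 1) / (2 * ip f g)).
  rewrite g0 mulr0 addr0.
  have -> : 2 * ((ip f f + 1) / (2 * ip f g) * ip f g) = ip f f + 1.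
    by field.
  lra.
have gp : 0 < ip g g by rewrite lt_def g0 ip_ge0.
have := q (ip f g / ip g g).
have -> : ip f f - 2 * (ip f g / ip g g * ip f g) +
    (ip f g / ip g g) ^+ 2 * ip g g = (ip f f * ip g g - ip f g ^+ 2) / ip g g.
  by field.
by rewrite pmulr_lge0 ?invr_gt0// subr_ge0.
Qed.

Lemma geometric_half_le2 (K : realFieldType) n :
  \sum_(0 <= k < n) 2^-1 ^+ k <= 2 :> K.
Proof.
suff -> : \sum_(0 <= k < n) 2^-1 ^+ k = 2 - 2 * 2^-1 ^+ n :> K.
  by rewrite gerBl mulr_ge0// exprn_ge0// invr_ge0.
elim: n => [|n IH]; first by rewrite big_nil expr0; ring.
rewrite big_nat_recr//= IH exprS; set x := 2^-1 ^+ n; lra.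
Qed.

Lemma ip_finite_expansion (e : nat -> T -> R) f N : sqint f ->
  (forall k, sqint (e k)) -> (forall i j, ip (e i) (e j) = (i == j)%:R) ->
  let r := fun x => f x - \sum_(k < N) ip f (e k) * e k x in
  sqint r /\ forall g, sqint g -> ip g r = ip g f - \sum_(k < N) ip f (e k) * ip g (e k).
Proof.
move=> sf se on r.
have ss : sqint (fun x => \sum_(k < N) ip f (e k) * e k x).
  by apply: sqint_sum => i _; exact: sqintZ.
split; first exact: sqintB.
move=> g sg; rewrite /r ipBr// ip_sumr//; last by move=> i _; exact: sqintZ.
by congr (_ - _); apply: eq_bigr => i _; rewrite ipZr.
Qed.

Lemma bessel_residual (e : nat -> T -> R) f N : sqint f ->
  (forall k, sqint (e k)) -> (forall i j, ip (e i) (e j) = (i == j)%:R) ->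
  let r := fun x => f x - \sum_(k < N) ip f (e k) * e k x in
  ip r r = ip f f - \sum_(k < N) ip f (e k) ^+ 2.
Proof.
move=> sf se on r.
have [sr rE] := ip_finite_expansion N sf se on.
have rk (i : 'I_N) : ip r (e i) = 0.
  rewrite ipC rE// (bigD1 i)//= on eqxx mulr1 big1 ?addr0 ?(ipC f) ?subrr//.
  by move=> j ji; rewrite on eq_sym val_eqE (negbTE ji) mulr0.
rewrite {2}/r -/r rE// big1 ?subr0; last by move=> i _; rewrite rk mulr0.
by rewrite ipC rE//; congr (_ - _); apply: eq_bigr => i _; rewrite expr2.
Qed.

(* [\sum_n 2^n (u_(n+1) - u_n)^2] is integrable, hence finite a.e., and it controls
   [\sum_n |u_(n+1) - u_n|] by AM-GM; Fatou then bounds the distance to the limit. *)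
Lemma riesz_fischer (u : nat -> T -> R) :
  (forall n, sqint (u n)) ->
  (forall n m, (n <= m)%N ->
    ip (fun x => u n x - u m x) (fun x => u n x - u m x) <= 4^-1 ^+ n) ->
  exists2 r, sqint r &
    forall n, ip (fun x => u n x - r x) (fun x => u n x - r x) <= 4^-1 ^+ n.
Proof.
move=> su cu.
pose dd n x := u n.+1 x - u n x.
have sdd n : sqint (dd n) by exact: sqintB.
pose S x := (\sum_(0 <= n <oo) (2 ^+ n * dd n x ^+ 2)%:E)%E.
have mterm n : measurable_fun setT (fun x => (2 ^+ n * dd n x ^+ 2)%:E).
  apply/measurable_EFinP; apply: measurable_funM => //.
  exact/measurable_funX/sqint_measurable.
have term0 n x : (0 <= (2 ^+ n * dd n x ^+ 2)%:E)%E.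
  by rewrite lee_fin; apply: mulr_ge0; [exact: exprn_ge0|exact: sqr_ge0].
have mS : measurable_fun setT S by exact: ge0_emeasurable_sum.
have S0 x : (0 <= S x)%E by exact: nneseries_ge0.
have IS : (\int[mu]_x S x < +oo)%E.
  rewrite integral_nneseries//.
  have h n : (\int[mu]_x (2 ^+ n * dd n x ^+ 2)%:E <= (2^-1 ^+ n)%:E)%E.
    have id2 : Rintegrable (fun x => 2 ^+ n * dd n x ^+ 2).
      exact/RintegrableZ/(sdd n).2.
    rewrite -[leLHS]fineK; last exact: (integrable_fin_num measurableT id2).
    rewrite lee_fin -/(Rintegral _ _ _) RintegralZl//; last exact: (sdd n).2.
    have := cu n n.+1 (leqnSn n).
    have -> : ip (fun x => u n x - u n.+1 x) (fun x => u n x - u n.+1 x) =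
        \int[mu]_x (dd n x ^+ 2).
      by apply: eq_Rintegral => x _; rewrite /dd; ring.
    have -> : 2^-1 ^+ n = 2 ^+ n * 4^-1 ^+ n :> R.
      by rewrite -exprMn; congr (_ ^+ n); lra.
    by move=> le4; rewrite ler_pM2l// exprn_gt0.
  apply: (@le_lt_trans _ _ (\sum_(0 <= n <oo) (2^-1 ^+ n)%:E)%E).
    apply: lee_nneseries => [n _ _|n _].
      by apply: integral_ge0 => x _; exact: term0.
    exact: h.
  apply: (@le_lt_trans _ _ 2%:E); last exact: ltry.
  apply: lime_le; first by apply: is_cvg_nneseries => n _ _; rewrite lee_fin exprn_ge0.
  apply: nearW => n; rewrite sumEFin lee_fin.
  exact: geometric_half_le2.
have SI : mu.-integrable setT S.
  apply/integrableP; split => //.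
  by under eq_integral do rewrite gee0_abs//.
pose A := [set x | (S x < +oo)%E].
have mA : measurable A.
  by have := emeasurable_fun_infty_o measurableT mS +oo%E; rewrite setTI.
have cvgA x : A x -> cvgn (fun n => u n x).
  move=> Ax.
  have Sfin : S x \is a fin_num by rewrite ge0_fin_numE.
  have dcvg : cvgn (series (fun n => dd n x)).
    apply: normed_cvg; apply: nondecreasing_is_cvgn.
      by apply: nondecreasing_series => n _ _; exact: normr_ge0.
    exists (2 + fine (S x)) => _ [n _ <-].
    have h k : `|dd k x| <= 2^-1 ^+ k + 2 ^+ k * dd k x ^+ 2.
      have p0 : 0 < 2 ^+ k :> R by rewrite exprn_gt0.
      rewrite exprVn -(ler_pM2l p0) mulrDr divff ?gt_eqF// mulrA -expr2 -exprMn.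
      rewrite -[in leLHS](gtr0_norm p0) -normrM.
      set z := 2 ^+ k * _; rewrite ler_norml; apply/andP; split; nra.
    apply: (@le_trans _ _ (\sum_(0 <= k < n) 2^-1 ^+ k + \sum_(0 <= k < n) 2 ^+ k * dd k x ^+ 2)).
      by rewrite -big_split/=; apply: ler_sum => k _; exact: h.
    apply: lerD; last first.
      rewrite -lee_fin fineK// -sumEFin.
      by apply: nneseries_lim_ge.
    exact: geometric_half_le2.
  have -> : (fun n => u n x) = (fun n => u 0 x + series (fun n => dd n x) n).
    apply/funext => n; rewrite /series/= telescope_sumr//.
    by rewrite addrC subrK.
  by apply: is_cvgD => //; exact: is_cvg_cst.
pose v n x := u n x * \1_A x.
have mv n : measurable_fun setT (v n).
  apply: measurable_funM; first exact: sqint_measurable.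
  exact: measurable_indic.
have sv n : sqint (v n).
  apply: (sqint_le (mv n) (su n)) => x; rewrite /v normrM indicE.
  by case: (x \in A); rewrite ?normr1 ?normr0 ?mulr1 ?mulr0.
pose r x := limn (fun n => v n x).
have vr x : v n x @[n --> \oo] --> r x.
  suff : cvgn (fun n => v n x) by [].
  rewrite /v indicE; case: (boolP (x \in A)) => [/set_mem xA|xA].
    under eq_fun do rewrite mulr1; exact: cvgA.
  under eq_fun do rewrite mulr0; exact: is_cvg_cst.
have mr : measurable_fun setT r.
  by apply: (measurable_fun_cvg mv) => x _; exact: vr.
have vle n m : (n <= m)%N ->
    (\int[mu]_x ((v n x - v m x) ^+ 2)%:E <= (4^-1 ^+ n)%:E)%E.
  move=> nm; have svv : sqint (fun x => v n x - v m x) by exact: sqintB.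
  have suu : sqint (fun x => u n x - u m x) by exact: sqintB.
  rewrite -[leLHS]fineK; last exact: (integrable_fin_num measurableT svv.2).
  rewrite lee_fin; apply: le_trans (cu n m nm).
  apply: le_Rintegral => //; [exact: svv.2|exact: sqint_mul|].
  move=> x _; rewrite /v -mulrBl exprMn indicE.
  by case: (x \in A); rewrite ?expr1n ?mulr1 ?expr0n ?mulr0 ?expr2 -?expr2 ?sqr_ge0.
have rle n : (\int[mu]_x ((v n x - r x) ^+ 2)%:E <= (4^-1 ^+ n)%:E)%E.
  have := @fatou _ _ _ mu setT measurableT (fun m x => ((v n x - v m x) ^+ 2)%:E) _ _.
  have -> : (fun x => limn_einf (fun m => ((v n x - v m x) ^+ 2)%:E)) =
      (fun x => ((v n x - r x) ^+ 2)%:E).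
    apply/funext => x; apply: (cvg_limn_einf_sup _).1.
    apply/cvg_EFin; first exact: nearW.
    apply: (@cvg_comp _ _ _ (fun m => v n x - v m x) (fun y => y ^+ 2)); last exact: exprn_continuous.
    by apply: cvgB; [exact: cvg_cst|exact: vr].
  move=> fat; apply: (le_trans (fat _ _)).
  - move=> m; apply/measurable_EFinP; apply: measurable_funX.
    exact: measurable_funB.
  - by move=> m x _; rewrite lee_fin sqr_ge0.
  - rewrite limn_einf_lim; apply: lime_le; first exact: is_cvg_einfs.
    near=> m; apply: (@le_trans _ _ (\int[mu]_x ((v n x - v m x) ^+ 2)%:E)%E).
      by apply: ereal_inf_lbound; exists m => //=.
    by apply: vle; near: m; exact: nbhs_infty_ge.
have svr n : sqint (fun x => v n x - r x).
  split; first exact: measurable_funB.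
  apply/integrableP; split.
    by apply/measurable_EFinP/measurable_funX; exact: measurable_funB.
  under eq_integral do rewrite gee0_abs ?lee_fin ?sqr_ge0//.
  by rewrite (le_lt_trans (rle n))// ltry.
have sr : sqint r.
  have -> : r = (fun x => v 0 x - (v 0 x - r x)) by apply/funext => x; ring.
  exact: sqintB.
exists r => // n.
have -> : ip (fun x => u n x - r x) (fun x => u n x - r x) =
    ip (fun x => v n x - r x) (fun x => v n x - r x).
  congr fine; apply: ge0_ae_eq_integral => //.
  - have mur : measurable_fun setT (fun x => u n x - r x).
      by apply: measurable_funB => //; exact: sqint_measurable.
    by apply/measurable_EFinP; exact: measurable_funM.
  - have mvr := sqint_measurable (svr n).
    by apply/measurable_EFinP; exact: measurable_funM.
  - by move=> x _; rewrite lee_fin -expr2 sqr_ge0.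
  - by move=> x _; rewrite lee_fin -expr2 sqr_ge0.
  have := integrable_ae measurableT SI.
  apply: filterS => x /(_ I) Sx _.
  have Ax : A x by rewrite /A/= -ge0_fin_numE.
  by rewrite /v indicE mem_set// mulr1.
rewrite -lee_fin; apply: le_trans (rle n).
rewrite /ip /Rintegral fineK//; last by rewrite (integrable_fin_num measurableT (sqint_mul (svr n) (svr n))).
Unshelve. all: by end_near.
Qed.

(* The residuals are Cauchy by Bessel, so a subsequence converges by
   Riesz-Fischer; its limit is orthogonal to every [e k], hence null. *)
Lemma parseval (e : nat -> T -> R) f g :
  (forall k, sqint (e k)) -> (forall i j, ip (e i) (e j) = (i == j)%:R) ->
  (forall h, sqint h -> (forall k, ip h (e k) = 0) -> {ae mu, forall x, h x = 0}) ->
  sqint f -> sqint g ->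
  (\sum_(k < N) ip f (e k) * ip g (e k)) @[N --> \oo] --> ip g f.
Proof.
move=> se on ce sf sg.
pose r N x := f x - \sum_(k < N) ip f (e k) * e k x.
have sr N : sqint (r N) by exact: (ip_finite_expansion N sf se on).1.
have rE N h (sh : sqint h) := (ip_finite_expansion N sf se on).2 h sh.
have rr N : ip (r N) (r N) = ip f f - \sum_(k < N) ip f (e k) ^+ 2.
  exact: bessel_residual.
pose s N := \sum_(k < N) ip f (e k) ^+ 2.
have rk N k : (k < N)%N -> ip (r N) (e k) = 0.
  move=> kN; rewrite ipC rE// (bigD1 (Ordinal kN))//= on eqxx mulr1.
  rewrite big1 ?addr0 ?(ipC f) ?subrr// => j ji.
  by rewrite on eq_sym -val_eqE/= in ji *; rewrite (negbTE ji) mulr0.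
have rf N M : (N <= M)%N -> ip (r M) (r N) = ip (r M) f.
  move=> NM; rewrite rE// big1 ?subr0// => i _.
  by rewrite rk ?mulr0// (leq_trans (ltn_ord i)).
have distr N M : (N <= M)%N ->
    ip (fun x => r N x - r M x) (fun x => r N x - r M x) = s M - s N.
  move=> NM; rewrite ip_sqrB// (ipC (r N) (r M)) (rf N M)// -(rf M M)// !rr /s; ring.
have nds : {homo s : n m / (n <= m)%N >-> n <= m}.
  by move=> N M NM; rewrite -subr_ge0 -distr// ip_ge0.
have cs : cvgn s.
  apply: nondecreasing_is_cvgn => //; exists (ip f f) => _ [n _ <-].
  by rewrite -subr_ge0 -rr ip_ge0.
have sl N : s N <= limn s by exact: nondecreasing_cvgn_le.
have /choice[p pP] : forall i, exists n,
    (i <= n)%N /\ limn s - s n <= 4^-1 ^+ i.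
  move=> i.
  have e0 : 0 < 4^-1 ^+ i :> R by rewrite exprn_gt0// invr_gt0.
  have /cvgrPdist_le /(_ _ e0) [N _ NP] := cs.
  exists (maxn i N); split; first exact: leq_maxl.
  by apply: le_trans (NP (maxn i N) (leq_maxr _ _)); exact: ler_norm.
have pow4 n m : (n <= m)%N -> 4^-1 ^+ m <= 4^-1 ^+ n :> R.
  by move=> nm; apply: ler_wiXn2l => //; rewrite invf_le1 ?ler1n.
have [q sq qP] : exists2 q, sqint q & forall n,
    ip (fun x => r (p n) x - q x) (fun x => r (p n) x - q x) <= 4^-1 ^+ n.
  apply: (@riesz_fischer (fun n => r (p n))) => // n m nm.
  have [pnm|/ltnW pmn] := leqP (p n) (p m).
    rewrite distr//; by apply: le_trans (pP n).2; rewrite lerB.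
  rewrite (_ : ip _ _ = ip (fun x => r (p m) x - r (p n) x) (fun x => r (p m) x - r (p n) x)).
    by rewrite distr//; apply: le_trans (pow4 _ _ nm); apply: le_trans (pP m).2; rewrite lerB.
  by apply: eq_Rintegral => x _; ring.
have cvg4 (eps : R) : 0 < eps -> exists n0, forall n, (n0 <= n)%N -> 4^-1 ^+ n < eps.
  move=> eps0.
  have : (fun n => 4^-1 ^+ n : R) @ \oo --> (0 : R).
    by apply: cvg_expr; rewrite ger0_norm ?invr_ge0// invf_lt1 ?ltr1n.
  move=> /cvgrPdist_lt/(_ _ eps0)[n0 _ n0P]; exists n0 => n /n0P/=.
  by rewrite sub0r normrN ger0_norm// exprn_ge0// invr_ge0.
have q0 : {ae mu, forall x, q x = 0}.
  apply: ce => // k; apply/eqP; rewrite -sqrf_eq0 eq_le sqr_ge0 andbT.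
  apply/ler_addgt0Pr => eps /cvg4[n0 n0P]; rewrite add0r.
  pose n := maxn n0 k.+1.
  apply: le_trans (ltW (n0P n (leq_maxl _ _))).
  have srq : sqint (fun x => r (p n) x - q x) by exact: sqintB.
  have := cauchy_schwarz srq (se k).
  rewrite on eqxx mulr1 (ipC _ (e k)) ipBr// (ipC _ (r (p n))) rk; last first.
    by apply: leq_trans (pP n).1; exact: leq_maxr.
  by rewrite sub0r sqrrN (ipC _ q) => /le_trans; apply.
have rp n : ip (r (p n)) (r (p n)) <= 4^-1 ^+ n.
  apply: le_trans (qP n); rewrite le_eqVlt; apply/orP; left; apply/eqP.
  have srq : sqint (fun x => r (p n) x - q x) by exact: sqintB.
  congr fine; apply: ge0_ae_eq_integral => //.
  - exact: (measurable_int mu (sqint_mul (sr _) (sr _))).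
  - exact: (measurable_int mu (sqint_mul srq srq)).
  - by move=> x _; rewrite lee_fin -expr2 sqr_ge0.
  - by move=> x _; rewrite lee_fin -expr2 sqr_ge0.
  by apply: filterS q0 => x qx _; rewrite qx subr0.
apply/cvgrPdist_lt => eps eps0.
have gg1 : 0 < ip g g + 1 by rewrite ltr_wpDl// ip_ge0.
have [n0 n0P] := cvg4 (eps ^+ 2 / (ip g g + 1)) (divr_gt0 (exprn_gt0 2 eps0) gg1).
exists (p n0) => // N /= pN.
have -> : \sum_(k < N) ip f (e k) * ip g (e k) = ip g f - ip g (r N).
  by rewrite rE// opprB addrCA subrr addr0.
rewrite opprB addrCA subrr addr0 -(@ltr_pXn2r _ 2)// ?nnegrE ?(ltW eps0)//.
rewrite real_normK ?num_real//.
apply: le_lt_trans (cauchy_schwarz sg (sr N)) _.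
have rN : ip (r N) (r N) < eps ^+ 2 / (ip g g + 1).
  apply: le_lt_trans (n0P n0 (leqnn _)); apply: le_trans (rp n0).
  by rewrite !rr lerB// nds.
move: rN; rewrite ltr_pdivlMr// => rN; apply: le_lt_trans rN.
have := ip_ge0 (r N); have := ip_ge0 g; nra.
Qed.

Lemma Rintegral_dominated_cvg (F : nat -> T -> R) f g :
  (forall n, measurable_fun setT (F n)) ->
  (forall x, F n x @[n --> \oo] --> f x) ->
  Rintegrable g -> (forall n x, `|F n x| <= g x) ->
  Rintegrable f /\ (\int[mu]_x F n x @[n --> \oo] --> \int[mu]_x f x).
Proof.
move=> mF Ff gi Fg.
have mf : measurable_fun setT f by apply: (measurable_fun_cvg mF) => x _; exact: Ff.
have [||||fi _ cv] := @dominated_convergence _ _ _ mu setT measurableT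
  (fun n x => (F n x)%:E) (EFin \o f) (EFin \o g) _ _ _ gi.
- by move=> n; apply/measurable_EFinP.
- exact/measurable_EFinP.
- by apply: aeW => x _; apply/cvg_EFin; [exact: nearW|exact: Ff].
- by apply: aeW => x n _; rewrite lee_fin.
split; first exact: fi.
apply: fine_cvg; rewrite fineK//.
exact: (integrable_fin_num measurableT fi).
Qed.

End SquareIntegrable.

(** * Completed Lebesgue measure and Gaussian weights *)

Section LebesgueBorel.
Variable R : realType.
Implicit Types f : R -> R.

Lemma leb_measurable_borel f :
  measurable_fun (setT : set (measurableTypeR R)) f -> leb_measurable f.
Proof.
move=> mf _ Y mY; have := mf measurableT Y mY.
exact: sub_caratheodory.
Qed.

Lemma ge0_integral_leb (D : set R) (f : R -> \bar R) :
  measurable (D : set (measurableTypeR R)) ->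
  measurable_fun (D : set (measurableTypeR R)) f -> (forall x, 0 <= f x)%E ->
  (\int[leb R]_(x in (D : set (LebR R))) f x =
   \int[@lebesgue_measure R]_(x in (D : set (measurableTypeR R))) f x)%E.
Proof.
move=> mD mf f0.
have mid : measurable_fun (setT : set (LebR R)) (id : LebR R -> measurableTypeR R).
  move=> _ Y mY; rewrite setTI; exact: sub_caratheodory.
have := @ge0_integral_pushforward _ _ (LebR R) (measurableTypeR R) R id mid (leb R) D f mD mf (fun y _ => f0 y).
rewrite preimage_id => <-.
by apply: eq_measure_integral.
Qed.

Lemma integrable_leb (D : set R) f :
  measurable (D : set (measurableTypeR R)) ->
  (@lebesgue_measure R).-integrable (D : set (measurableTypeR R)) (EFin \o f) ->
  (leb R).-integrable (D : set (LebR R)) (EFin \o f).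
Proof.
move=> mD /integrableP[mf foo]; apply/integrableP; split.
  move=> mD' Y mY; exact: sub_caratheodory (mf mD Y mY).
rewrite ge0_integral_leb//; exact: measurableT_comp.
Qed.

Lemma integral_leb (D : set R) f :
  measurable (D : set (measurableTypeR R)) ->
  measurable_fun (D : set (measurableTypeR R)) f ->
  lint_on D f = \int[@lebesgue_measure R]_(x in D) f x.
Proof.
move=> mD /measurable_EFinP mf; rewrite /lint_on /Rintegral; congr fine.
rewrite [LHS]integralE [RHS]integralE !ge0_integral_leb//.
- exact: measurable_funeneg.
- exact: measurable_funepos.
Qed.

Lemma is_derive_mul f g (x a b : R) :
  is_derive x (1 : R) f a -> is_derive x (1 : R) g b ->
  is_derive x (1 : R) (fun y => f y * g y) (a * g x + f x * b).
Proof.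
move=> df dg; apply: (is_derive_eq (is_deriveM df dg)).
by rewrite /GRing.scale/= addrC mulrC.
Qed.

Lemma is_derive_add f g (x a b : R) :
  is_derive x (1 : R) f a -> is_derive x (1 : R) g b ->
  is_derive x (1 : R) (fun y => f y + g y) (a + b).
Proof. by move=> df dg; exact: (is_deriveD df dg). Qed.

Lemma is_derive_opp f (x a : R) :
  is_derive x (1 : R) f a -> is_derive x (1 : R) (fun y => - f y) (- a).
Proof. by move=> df; exact: (is_deriveN df). Qed.

Lemma is_derive_continuous f (df : R -> R) :
  (forall x : R, is_derive x (1 : R) f (df x)) -> continuous f.
Proof.
move=> dfP x; apply: differentiable_continuous; apply/derivable1_diffP.
by have [] := dfP x.
Qed.

Lemma is_derive_expR_scaled_sq (c x : R) :
  is_derive x (1 : R) (fun y => expR (c * y ^+ 2)) (2 * c * x * expR (c * x ^+ 2)).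
Proof.
have dq : is_derive x (1 : R) (fun y : R => c * (y * y)) (2 * c * x).
  have dx := is_derive_id x (1 : R).
  apply: (is_derive_eq (is_derive_mul (is_derive_cst c x 1) (is_derive_mul dx dx))).
  rewrite /cst/=; ring.
apply: (is_derive_eq (is_derive1_comp (is_derive_expR _) dq)).
by rewrite mulrC.
Qed.

Lemma FTC2_leb (f F : R -> R) (a b : R) : a <= b -> continuous f ->
  (forall x : R, is_derive x (1 : R) F (f x)) -> lint_on `[a, b] f = F b - F a.
Proof.
move=> ab cf dF; rewrite integral_leb//; last first.
  by apply: measurable_funTS; exact: continuous_measurable_fun.
move: ab; rewrite le_eqVlt => /predU1P[<-|ab].
  by rewrite subrr set_itv1 Rintegral_set1.
rewrite /Rintegral (@continuous_FTC2 _ f F)//.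
- exact: continuous_subspaceT.
- have cF := is_derive_continuous dF.
  split; first by move=> x _; have [] := dF x.
    by apply: cvg_at_right_filter; exact: cF.
  by apply: cvg_at_left_filter; exact: cF.
- by move=> x _; rewrite derive1E; have := dF x => -[_ ->].
Qed.

Lemma continuous_leb_measurable f : continuous f -> leb_measurable f.
Proof. by move=> cf; apply: leb_measurable_borel; exact: continuous_measurable_fun. Qed.

Lemma pow_le_expR n (y : R) : 0 <= y -> y ^+ n <= n`!%:R * expR y.
Proof.
move=> y0; have f0 : 0 < n`!%:R :> R by rewrite ltr0n fact_gt0.
rewrite -ler_pdivrMl// mulrC; case: n {f0} => [|n].
  by rewrite expr0 fact0 divr1; apply: le_trans (expR_ge1Dx y); rewrite lerDl.
by apply: le_trans (expR_ge1Dxn n y0); rewrite lerDr.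
Qed.

Lemma expR_half_sq (x : R) : expR (- (x ^+ 2 / 2)) * expR (- (x ^+ 2 / 2)) = expR (- x ^+ 2).
Proof. by rewrite -expRD; congr expR; field. Qed.

Lemma poly_gauss_bound (p : {poly R}) : exists2 K : R, 0 <= K &
  forall x, `|p.[x] * expR (- x ^+ 2)| <= K * expR (- (x ^+ 2 / 2)).
Proof.
pose c i : R := 1 + i`!%:R * 2 ^+ i.
have c0 i : 0 <= c i by rewrite /c; apply: addr_ge0 => //; exact: mulr_ge0.
exists (\sum_(i < size p) `|p`_i| * c i).
  by apply: sumr_ge0 => i _; exact: mulr_ge0.
move=> x; rewrite -expR_half_sq mulrA normrM [X in _ * X]gtr0_norm ?expR_gt0//.
rewrite ler_pM2r ?expR_gt0// normrM [X in _ * X]gtr0_norm ?expR_gt0//.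
rewrite expRN ler_pdivrMr ?expR_gt0// horner_coef mulr_suml.
apply: le_trans (ler_norm_sum _ _ _) _; apply: ler_sum => i _.
rewrite normrM -mulrA ler_wpM2l// normrX.
have e1 : 1 <= expR (x ^+ 2 / 2) by rewrite -expR0 ler_expR divr_ge0// sqr_ge0.
have hp := pow_le_expR i (divr_ge0 (sqr_ge0 x) (ler0n R 2)).
have h2 : (x ^+ 2) ^+ i <= i`!%:R * 2 ^+ i * expR (x ^+ 2 / 2).
  rewrite expr_div_n ler_pdivrMr ?exprn_gt0// in hp.
  by rewrite mulrAC.
have : `|x| ^+ i <= 1 + (x ^+ 2) ^+ i.
  have : (`|x| ^+ i) ^+ 2 = (x ^+ 2) ^+ i by rewrite exprAC real_normK ?num_real.
  move: (`|x| ^+ i) ((x ^+ 2) ^+ i) => u v; nra.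
rewrite /c mulrDl mul1r; lra.
Qed.

Lemma integrable_gauss_half :
  leb_integrable (fun x : R => expR (- (x ^+ 2 / 2))).
Proof.
apply: integrable_leb => //.
have := integrable_normal_pdf (0 : R) 1.
move=> /(integrableZl measurableT (normal_peak 1)^-1).
apply: eq_integrable => // x _ /=.
rewrite -EFinM normal_pdfE ?oner_eq0// -[X in _ * X]/(normal_peak 1 * normal_fun 0 1 x).
rewrite mulKf ?gt_eqF ?normal_peak_gt0 ?oner_eq0//.
by rewrite /normal_fun subr0 expr1n mulNr.
Qed.

Lemma integrable_poly_gauss (p : {poly R}) :
  leb_integrable (fun x => p.[x] * expR (- x ^+ 2)).
Proof.
have [K K0 Kp] := poly_gauss_bound p.
apply: (Rintegrable_le _ (RintegrableZ K integrable_gauss_half) Kp).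
apply: continuous_leb_measurable => x; apply: cvgM; first exact: continuous_horner.
exact: continuous_gauss_fun.
Qed.

End LebesgueBorel.

(** * Hermite polynomials *)

Section HermitePolynomials.
Variable R : realType.
Implicit Types (p q : {poly R}) (m n k : nat).

Fixpoint hpoly_pair n : {poly R} * {poly R} :=
  if n is m.+1 then
    let p := hpoly_pair m in
    (p.2, 2%:R * 'X * p.2 - 2%:R * m.+1%:R * p.1)
  else (1, 2%:R * 'X).
Definition hpoly n := (hpoly_pair n).1.

Lemma hpoly0 : hpoly 0 = 1. Proof. by []. Qed.

Lemma hpoly1 : hpoly 1 = 2%:R * 'X. Proof. by []. Qed.

Lemma hpolySS n :
  hpoly n.+2 = 2%:R * 'X * hpoly n.+1 - 2%:R * n.+1%:R * hpoly n.
Proof. by []. Qed.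

Lemma hornerE_nat n (x : R) : (n%:R : {poly R}).[x] = n%:R.
Proof. by rewrite -polyC_natr hornerC. Qed.

Lemma horner_hpoly n x : (hpoly n).[x] = hermite n x.
Proof.
suff : (hpoly n).[x] = hermite n x /\ (hpoly n.+1).[x] = hermite n.+1 x by case.
elim: n => [|n [IH1 IH2]].
  by rewrite hpoly0 hpoly1 /hermite/= hornerM hornerE_nat hornerX hornerE.
split=> //; rewrite hpolySS !hornerD hornerN !hornerM hornerX !hornerE_nat IH1 IH2.
by rewrite /hermite/=.
Qed.

Lemma deriv_nat n : (n%:R : {poly R})^`() = 0.
Proof. by rewrite -polyC_natr derivC. Qed.

Lemma deriv_hpoly n : (hpoly n)^`() = 2%:R * n%:R * hpoly n.-1.
Proof.
suff : (hpoly n)^`() = 2%:R * n%:R * hpoly n.-1 /\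
       (hpoly n.+1)^`() = 2%:R * n.+1%:R * hpoly n by case.
elim: n => [|n [IH1 IH2]].
  rewrite hpoly0 hpoly1 derivM derivX deriv_nat -polyC1 derivC polyC1.
  by split; ring.
split=> //; rewrite hpolySS derivB !derivM derivX !deriv_nat IH1 IH2.
case: n {IH1 IH2} => [|n]; first by rewrite hpoly0 hpoly1; ring.
rewrite /= hpolySS -[n.+3]addn1 -[n.+2]addn1 -[n.+1]addn1 !natrD; ring.
Qed.

Lemma hpoly_raise n : hpoly n.+1 = 2%:R * 'X * hpoly n - (hpoly n)^`().
Proof.
rewrite deriv_hpoly; case: n => [|n]; last by rewrite hpolySS.
by rewrite hpoly0 hpoly1; ring.
Qed.

(* [f |-> H_m f] satisfies [T_(m+1) f = U (T_m f) + T_m f'], where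
   [U p = 2 x p - p'] is the raising operator. *)
Lemma hpoly_linearization m n : hpoly m * hpoly n =
  \sum_(r < m.+1) ('C(m, r) * 2 ^ r * n ^_ r)%:R * hpoly (m + n - r.*2).
Proof.
elim: m n => [|m IH] n.
  rewrite big_ord_recl big_ord0 hpoly0 bin0 expn0 ffactn0 !muln1.
  by rewrite add0n subn0 addr0.
have -> : hpoly m.+1 * hpoly n =
    (2%:R * 'X * (hpoly m * hpoly n) - (hpoly m * hpoly n)^`()) +
    2%:R * n%:R * (hpoly m * hpoly n.-1).
  by rewrite hpoly_raise derivM (deriv_hpoly n); ring.
rewrite !IH raddf_sum !mulr_sumr -sumrB.
transitivity (\sum_(r < m.+1) ('C(m, r) * 2 ^ r * n ^_ r)%:R * hpoly (m.+1 + n - r.*2)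
   + \sum_(r < m.+1) ('C(m, r) * 2 ^ r.+1 * n ^_ r.+1)%:R * hpoly (m.+1 + n - r.+1.*2)).
  congr (_ + _); apply: eq_bigr => r _.
    rewrite -[X in _ - X = _]/((_ * _)^`()) derivM deriv_nat mul0r add0r.
    have [rn|nr] := leqP r n; last by rewrite (ffact_small nr) muln0; ring.
    have -> : (m.+1 + n - r.*2 = (m + n - r.*2).+1)%N by have := ltn_ord r; lia.
    by rewrite hpoly_raise; ring.
  rewrite ffactnS; case: n => [|n]; first by rewrite mul0n muln0; ring.
  have -> : (m + n.+1.-1 - r.*2 = m.+1 + n.+1 - r.+1.*2)%N by lia.
  by rewrite !natrM expnS natrM; ring.
rewrite [RHS]big_ord_recl/= big_ord_recl/= !bin0.
rewrite [X in _ = _ + X](_ : _ =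
   \sum_(r < m.+1) ('C(m, r.+1) * 2 ^ r.+1 * n ^_ r.+1)%:R * hpoly (m.+1 + n - r.+1.*2)
 + \sum_(r < m.+1) ('C(m, r) * 2 ^ r.+1 * n ^_ r.+1)%:R * hpoly (m.+1 + n - r.+1.*2)); last first.
  rewrite -big_split/=; apply: eq_bigr => r _.
  by rewrite /bump/= add1n binS !natrM natrD; ring.
rewrite addrA; congr (_ + _).
rewrite [in RHS]big_ord_recr/= bin_small// !mul0n mul0r addr0.
by congr (_ + _); apply: eq_bigr => r _; rewrite /bump/= add1n.
Qed.

End HermitePolynomials.

Section GaussianMoments.
Variable R : realType.
Implicit Types (p q : {poly R}) (m n k : nat).

Definition gint p := lint (fun x => p.[x] * expR (- x ^+ 2)).

Lemma gintD p q : gint (p + q) = gint p + gint q.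
Proof.
rewrite /gint/lint; under eq_Rintegral do rewrite hornerD mulrDl.
by rewrite RintegralD//; exact: integrable_poly_gauss.
Qed.

Lemma gintZ (c : R) p : gint (c%:P * p) = c * gint p.
Proof.
rewrite /gint/lint; under eq_Rintegral do rewrite hornerM hornerC -mulrA.
by rewrite RintegralZl//; exact: integrable_poly_gauss.
Qed.

Lemma gint_natl n p : gint (n%:R * p) = n%:R * gint p.
Proof. by rewrite -polyC_natr gintZ. Qed.

Lemma gintN p : gint (- p) = - gint p.
Proof.
apply/eqP; rewrite -addr_eq0 -gintD addNr /gint/lint.
under eq_Rintegral do rewrite horner0 mul0r.
by rewrite Rintegral_cst// mul0r.
Qed.

Lemma gint_sum n (F : 'I_n -> {poly R}) :
  gint (\sum_(i < n) F i) = \sum_(i < n) gint (F i).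
Proof.
apply: (big_morph gint gintD).
by have := gint_natl 0 0; rewrite !mul0r.
Qed.

Lemma gint1 : gint 1 = Num.sqrt pi.
Proof.
rewrite /gint /lint; under eq_Rintegral do rewrite hornerE mul1r.
have mg : measurable_fun setT (@gauss_fun R) by exact: measurable_gauss_fun.
have := @integral_leb R setT (@gauss_fun R) measurableT mg.
rewrite /lint_on => ->.
by rewrite /Rintegral integralT_gauss.
Qed.

Lemma cvg_poly_gauss p : (p.[n%:R] * expR (- n%:R ^+ 2)) @[n --> \oo] --> 0.
Proof.
have [K K0 Kp] := poly_gauss_bound p.
apply/cvgrPdist_le => e e0; near=> n.
rewrite sub0r normrN; apply: le_trans (Kp _) _.
have n1 : 1 <= n%:R :> R by rewrite ler1n; near: n; exact: nbhs_infty_gt.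
have Ke : K / e <= n%:R / 2.
  rewrite ler_pdivlMr//; near: n; exact: nbhs_infty_ger.
rewrite expRN ler_pdivrMr ?expR_gt0//.
have h : n%:R / 2 <= expR (n%:R ^+ 2 / 2) :> R.
  apply: le_trans (expR_ge1Dx _); nra.
move: Ke; rewrite ler_pdivrMr// => Ke.
by apply: (le_trans Ke); rewrite mulrC ler_pM2l.
Unshelve. all: by end_near.
Qed.

Lemma gint_raise p : gint (2%:R * 'X * p - p^`()) = 0.
Proof.
pose q := 2%:R * 'X * p - p^`().
pose f x := q.[x] * expR (- x ^+ 2).
pose P x := - (p.[x] * expR (- x ^+ 2)).
have cf : continuous f.
  by move=> x; apply: cvgM; [exact: continuous_horner|exact: continuous_gauss_fun].
have dP (x : R) : is_derive x (1 : R) P (f x).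
  have := is_derive_expR_scaled_sq (-1) x; under eq_fun do rewrite mulN1r.
  move=> dw; apply: (is_derive_eq (is_derive_opp (is_derive_mul (is_derive_poly p x) dw))).
  rewrite /f /q !mulN1r hornerD hornerN !hornerM hornerX hornerE_nat; ring.
have mf : leb_measurable f by exact: continuous_leb_measurable.
have fi : leb_integrable f by exact: integrable_poly_gauss.
have mI n : measurable (`[- n%:R, n%:R]%classic : set (LebR R)).
  by apply: sub_caratheodory; exact: measurable_itv.
have [||||_ cvf] := @Rintegral_dominated_cvg _ _ _ (leb R)
   (fun n x => (f \_ `[(- n%:R : R), n%:R]) x) f (fun x => `|f x|).
- by move=> n; apply/(measurable_restrictT _ _).1 => //; exact: measurable_funTS.
- move=> x; apply: cvg_near_cst; near=> n.
  rewrite patchE ifT// inE/= in_itv/= -ler_norml.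
  by near: n; exact: nbhs_infty_ger.
- exact: integrable_norm.
- by move=> n x; rewrite patchE; case: ifP; rewrite ?normr0.
have cv0 : (P n%:R - P (- n%:R)) @[n --> \oo] --> (0 : R).
  have -> : (fun n => P n%:R - P (- n%:R)) =
      (fun n => - (p.[n%:R] * expR (- n%:R ^+ 2)) + (p \Po - 'X).[n%:R] * expR (- n%:R ^+ 2)).
    apply/funext => n; rewrite /P opprK horner_comp hornerN hornerX.
    by rewrite sqrrN.
  rewrite -[X in _ --> X]addr0 -[X in X + _]oppr0.
  by apply: cvgD; [apply: cvgN|]; exact: cvg_poly_gauss.
have : (fun n => \int[leb R]_x (f \_ `[(- n%:R : R), n%:R]) x) = (fun n => P n%:R - P (- n%:R)).
  apply/funext => n; rewrite -Rintegral_mkcond.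
  by rewrite -[LHS]/(lint_on _ _) (FTC2_leb _ cf dP)// ge0_cp// ler0n.
move=> E; rewrite E in cvf.
exact: (cvg_unique _ cvf cv0).
Unshelve. all: by end_near.
Qed.

Lemma gint_hpoly k : gint (hpoly R k) = (k == 0%N)%:R * Num.sqrt pi.
Proof.
case: k => [|k]; first by rewrite hpoly0 gint1 mul1r.
by rewrite hpoly_raise gint_raise mul0r.
Qed.

(* Only the term [r = m = n] of the linearization has nonzero integral. *)
Lemma gint_hpoly_orthogonal m n :
  gint (hpoly R m * hpoly R n) = (m == n)%:R * (Num.sqrt pi * 2 ^+ n * n`!%:R).
Proof.
rewrite hpoly_linearization gint_sum.
under eq_bigr do rewrite gint_natl gint_hpoly.
rewrite big_ord_recr/= big1 ?add0r => [|r _].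
  rewrite binn mul1n.
  have [->|mn] := eqVneq m n.
    by rewrite ffactnn addnn subnn eqxx natrM natrX; ring.
  have [lt|ge] := leqP m n; last by rewrite ffact_small// muln0 !mul0r.
  rewrite (_ : _ == 0%N = false) ?mul0r ?mulr0//; apply/eqP; lia.
have [rn|nr] := leqP r n; last by rewrite ffact_small// muln0 mul0r.
rewrite (_ : _ == 0%N = false) ?mul0r ?mulr0//; apply/eqP; have := ltn_ord r; lia.
Qed.

End GaussianMoments.

(** * Integration by parts for weak derivatives *)

Section IntegrationByParts.
Variable R : realType.
Implicit Types f : R -> R.

Lemma leb_measurable_itv (i : interval R) : measurable ([set` i] : set (LebR R)).
Proof. by apply: sub_caratheodory; exact: measurable_itv. Qed.

Lemma continuous_integrable_on f (a b : R) : continuous f ->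
  (leb R).-integrable (`[a, b]%classic : set (LebR R)) (EFin \o f).
Proof.
move=> cf; apply: integrable_leb => //.
apply: continuous_compact_integrable; first exact: segment_compact.
exact: continuous_subspaceT.
Qed.

Lemma integrable_on_cst (a b c : R) :
  (leb R).-integrable (`[a, b]%classic : set (LebR R)) (EFin \o fun=> c).
Proof. by apply: continuous_integrable_on => x; exact: cvg_cst. Qed.

Lemma lint_on_cst (a b c : R) : a <= b -> lint_on `[a, b] (fun=> c) = c * (b - a).
Proof.
move=> ab.
have dF (x : R) : is_derive x (1 : R) (fun y : R => c * y) c.
  have dx := is_derive_id x (1 : R).
  apply: (is_derive_eq (is_derive_mul (is_derive_cst c x 1) dx)).
  by rewrite /cst/=; ring.
by rewrite (FTC2_leb ab (fun=> cvg_cst _) dF) mulrBr.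
Qed.

Lemma sqint_integrable_on f (a b : R) : L2 f ->
  (leb R).-integrable (`[a, b]%classic : set (LebR R)) (EFin \o f).
Proof.
move=> [mf f2].
have mI := leb_measurable_itv `[a, b].
have c1 := integrable_on_cst a b 1.
have f2I := integrableS measurableT mI (@subsetT _ _) f2.
have s1 := integrableD mI c1 f2I.
apply: (le_integrable mI _ _ s1).
  by apply/measurable_EFinP; exact: measurable_funTS.
move=> x _ /=; rewrite lee_fin (@ger0_norm _ (1 + _)) ?addr_ge0 ?sqr_ge0//.
rewrite ler_norml; apply/andP; split; nra.
Qed.

Lemma lint_on_half_open f (x y : R) : x <= y -> leb_integrable f ->
  lint_on `]-oo, y[ f = lint_on `]-oo, x[ f + lint_on `[x, y] f.
Proof.
move=> xy fi.
have fiI (i : interval R) : (leb R).-integrable ([set` i] : set (LebR R)) (EFin \o f).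
  by apply: integrableS fi => //; exact: leb_measurable_itv.
have E1 : `]-oo, y[%classic = `]-oo, x[%classic `|` `[x, y[%classic :> set R.
  by rewrite -itv_bndbnd_setU.
have E2 : `[x, y]%classic = `[x, y[%classic `|` [set y] :> set R.
  by rewrite setUitv1.
have my : measurable ([set y] : set (LebR R)).
  by rewrite -set_itv1; exact: leb_measurable_itv.
have -> : lint_on `[x, y] f = lint_on `[x, y[ f.
  rewrite {1}/lint_on E2 Rintegral_setU//; last 3 first.
  - exact: leb_measurable_itv.
  - by rewrite -E2; exact: fiI.
  - by apply/disj_set2P/seteqP; split => // z /= [] /[swap] ->; rewrite in_itv/= ltxx andbF.
  rewrite [X in _ + X](_ : _ = 0) ?addr0//.
  rewrite /Rintegral null_set_integral//; last exact: (@lebesgue_measure_set1 R y).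
  by apply: measurable_funTS; exact: (measurable_int (leb R) fi).
rewrite /lint_on E1 Rintegral_setU//.
- exact: leb_measurable_itv.
- exact: leb_measurable_itv.
- by rewrite -E1; exact: fiI.
- apply/disj_set2P/seteqP; split => // z /=; rewrite !in_itv/= => -[zx /andP[xz _]].
  by move: (le_lt_trans xz zx); rewrite ltxx.
Qed.

Lemma lint_on0 f (D : set R) : (forall x, D x -> f x = 0) -> lint_on D f = 0.
Proof.
move=> f0; rewrite /lint_on (@eq_Rintegral _ _ _ _ _ (cst 0)).
  by rewrite /Rintegral integral0.
by move=> x /set_mem; exact: f0.
Qed.

Lemma is_derive_lipschitz f (df : R -> R) (K : R) :
  (forall x : R, is_derive x (1 : R) f (df x)) -> (forall x, `|df x| <= K) ->
  forall x y, `|f y - f x| <= K * `|y - x|.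
Proof.
move=> dfP dK x y; wlog xy : x y / x <= y => [H|].
  have [/H//|/ltW/H] := leP x y.
  by rewrite distrC [X in _ * X]distrC.
have [|c _ ->] := @MVT_segment _ f df _ _ xy (fun x _ => dfP x).
  by apply: continuous_subspaceT; exact: is_derive_continuous dfP.
by rewrite normrM ler_wpM2r.
Qed.

Lemma compact_support_bounded f (M : R) : continuous f ->
  (forall x, M < `|x| -> f x = 0) -> exists2 K, 0 <= K & forall x, `|f x| <= K.
Proof.
move=> cf f0.
have aM : - `|M| <= `|M| by rewrite ge0_cp.
have [|c _ cP] := @EVT_max _ (fun x => `|f x|) _ _ aM.
  by apply: continuous_subspaceT => x; apply: cvg_norm; exact: cf.
exists `|f c| => // x; have [Mx|xM] := ltP `|M| `|x|.
  by rewrite f0 ?normr0// (le_lt_trans (ler_norm _) Mx).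
by apply: cP; rewrite in_itv/= -ler_norml.
Qed.

Lemma integrable_compact_support f (M K : R) : leb_measurable f ->
  (forall x, M < `|x| -> f x = 0) -> (forall x, `|f x| <= K) -> leb_integrable f.
Proof.
move=> mf f0 fK.
have K0 : 0 <= K by apply: le_trans (fK 0).
apply: (Rintegrable_le mf (RintegrableZ (K * expR (M ^+ 2 / 2)) (@integrable_gauss_half R))) => x.
have [Mx|xM] := ltP M `|x|.
  by rewrite f0// normr0 !mulr_ge0// ?expR_ge0.
apply: le_trans (fK x) _; rewrite -mulrA -expRD ler_peMr// -expR0 ler_expR.
rewrite -mulrBl divr_ge0// subr_ge0 -[x ^+ 2]real_normK ?num_real// ler_sqr ?nnegrE//.
exact: le_trans xM.
Qed.

Lemma sqint_compact_support f (M K : R) : leb_measurable f ->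
  (forall x, M < `|x| -> f x = 0) -> (forall x, `|f x| <= K) -> L2 f.
Proof.
move=> mf f0 fK; split => //.
apply: (@integrable_compact_support _ M (K ^+ 2)).
- exact: measurable_funX.
- by move=> x /f0 ->; rewrite expr0n.
- move=> x; rewrite normrX lerXn2r ?nnegrE//.
  exact: le_trans (fK x).
Qed.

Lemma lint_on_norm_le (g : R -> R) (x y s : R) : L2 g -> x <= y -> 0 < s ->
  lint_on `[x, y] (fun t => `|g t|) <= s * (y - x) + lint (fun t => g t ^+ 2) / s.
Proof.
move=> Lg xy s0; have [mg g2] := Lg.
have mI := leb_measurable_itv `[x, y].
have cs := integrable_on_cst x y s.
have g2s : leb_integrable (fun t => s^-1 * g t ^+ 2) by exact: RintegrableZ.
have g2sI := integrableS measurableT mI (@subsetT _ _) g2s.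
apply: (@le_trans _ _ (lint_on `[x, y] (fun t => s + s^-1 * g t ^+ 2))).
  apply: le_Rintegral => //.
  - exact/integrable_norm/sqint_integrable_on.
  - exact: (integrableD mI cs g2sI).
  move=> t _; rewrite -(ler_pM2l s0) mulrDr mulrA divff ?gt_eqF// mul1r -expr2.
  rewrite -[X in X * _](gtr0_norm s0) -normrM.
  rewrite ler_norml; apply/andP; split; nra.
rewrite /lint_on RintegralD// -/(lint_on _ _) lint_on_cst//.
have -> : lint (fun t => g t ^+ 2) / s = lint (fun t => s^-1 * g t ^+ 2).
  by rewrite [RHS]RintegralZl// mulrC.
rewrite lerD2l Rintegral_mkcond; apply: le_Rintegral => //.
- by rewrite -restrict_EFin; apply/(integrable_mkcond _ mI).
- move=> t _; rewrite patchE; case: ifP => // _.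
  by rewrite mulr_ge0 ?sqr_ge0// invr_ge0 ltW.
Qed.

Lemma lint_on_subset f (D E : set R) : D `<=` E ->
  measurable (D : set (LebR R)) -> measurable (E : set (LebR R)) ->
  (leb R).-integrable (E : set (LebR R)) (EFin \o f) -> (forall x, 0 <= f x) ->
  lint_on D f <= lint_on E f.
Proof.
move=> DE mD mE fE f0; apply: fine_le.
- by apply: (integrable_fin_num mD); exact: integrableS fE.
- exact: (integrable_fin_num mE).
apply: ge0_subset_integral => //; first exact: (measurable_int (leb R) fE).
by move=> x _; rewrite lee_fin.
Qed.

(* [F x = psi x * eta x - \int_{]-oo, x[} (g eta + psi eta')] satisfies
   [F y - F x = o(y - x)] by Cauchy-Schwarz for [g], so it is constant. *)
Lemma weak_deriv_by_parts (psi g eta deta : R -> R) (M : R) :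
  weak_deriv psi g -> (forall x : R, is_derive x (1 : R) eta (deta x)) ->
  continuous deta -> (forall x, M < `|x| -> eta x = 0 /\ deta x = 0) ->
  lint (fun x => g x * eta x) = - lint (fun x => psi x * deta x).
Proof.
move=> [Lpsi [Lg FTC]] dE cdE supp.
have cE := is_derive_continuous dE.
have [K K0 deK] := compact_support_bounded cdE (fun x h => (supp x h).2).
have [K' _ eK] := compact_support_bounded cE (fun x h => (supp x h).1).
have lipE := is_derive_lipschitz dE deK.
have LE : L2 eta.
  exact: (sqint_compact_support (continuous_leb_measurable cE) (fun x h => (supp x h).1) eK).
have LdE : L2 deta.
  exact: (sqint_compact_support (continuous_leb_measurable cdE) (fun x h => (supp x h).2) deK).
have i1 : leb_integrable (fun x => g x * eta x) by exact: sqint_mul.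
have i2 : leb_integrable (fun x => psi x * deta x) by exact: sqint_mul.
pose f x := g x * eta x + psi x * deta x.
have fi : leb_integrable f by exact: RintegrableD.
pose F x := psi x * eta x - lint_on `]-oo, x[ f.
pose B := lint (fun t => g t ^+ 2).
have B0 : 0 <= B by apply: Rintegral_ge0 => t _; exact: sqr_ge0.
have Fle (x y s : R) : x <= y -> 0 < s ->
    `|F y - F x| <= 2 * K * (y - x) * (s * (y - x) + B / s).
  move=> xy s0; apply: (@le_trans _ _ (2 * K * (y - x) * lint_on `[x, y] (fun t => `|g t|))); last first.
    apply: ler_wpM2l; last exact: lint_on_norm_le.
    by rewrite !mulr_ge0// subr_ge0.
  set J := lint_on _ _.
  have mI := leb_measurable_itv `[x, y].
  have on h : leb_integrable h -> (leb R).-integrable (`[x, y]%classic : set (LebR R)) (EFin \o h).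
    by move=> hi; exact: integrableS hi.
  have gI := sqint_integrable_on x y Lg.
  have psiI := sqint_integrable_on x y Lpsi.
  have dEI := continuous_integrable_on x y cdE.
  have psiJ t : t \in `[x, y] -> `|psi x - psi t| <= J.
    rewrite in_itv/= => /andP[xt ty]; rewrite distrC FTC//.
    have mt := leb_measurable_itv `[x, t].
    have gt := sqint_integrable_on x t Lg.
    apply: le_trans (le_normr_Rintegral mt gt) _.
    apply: lint_on_subset => //; last exact: integrable_norm.
    by move=> u /=; rewrite !in_itv/= => /andP[-> /le_trans]; apply.
  have c1 : (leb R).-integrable (`[x, y]%classic : set (LebR R))
      (EFin \o (fun t => eta y * g t)) := integrableZl mI (eta y) gI.
  have c2 : (leb R).-integrable (`[x, y]%classic : set (LebR R))
      (EFin \o (fun t => psi x * deta t)) := integrableZl mI (psi x) dEI.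
  have b1 : (leb R).-integrable (`[x, y]%classic : set (LebR R))
      (EFin \o (fun t => eta y * g t - g t * eta t)) := integrableB mI c1 (on _ i1).
  have b2 : (leb R).-integrable (`[x, y]%classic : set (LebR R))
      (EFin \o (fun t => psi x * deta t - psi t * deta t)) := integrableB mI c2 (on _ i2).
  have eqf : (fun t => g t * (eta y - eta t) + (psi x - psi t) * deta t) =
      (fun t => (eta y * g t - g t * eta t) + (psi x * deta t - psi t * deta t)).
    by apply/funext => t; ring.
  have i3 : (leb R).-integrable (`[x, y]%classic : set (LebR R))
      (EFin \o (fun t => g t * (eta y - eta t) + (psi x - psi t) * deta t)).
    by rewrite eqf; exact: (integrableD mI b1 b2).
  have -> : F y - F x = lint_on `[x, y] (fun t => g t * (eta y - eta t) + (psi x - psi t) * deta t).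
    have fE : lint_on `[x, y] f =
        lint_on `[x, y] (fun x => g x * eta x) + lint_on `[x, y] (fun x => psi x * deta x).
      by rewrite /lint_on RintegralD//; exact: on.
    rewrite /F (lint_on_half_open xy fi) fE eqf.
    rewrite [RHS]RintegralD// RintegralB//; last exact: on.
    rewrite RintegralB//; last exact: on.
    rewrite !RintegralZl// -!/(lint_on _ _) -FTC// (FTC2_leb xy cdE dE); ring.
  apply: le_trans (le_normr_Rintegral mI i3) _.
  apply: (@le_trans _ _ (lint_on `[x, y] (fun t => K * (y - x) * `|g t| + K * J))).
    apply: le_Rintegral => //.
    - exact: integrable_norm.
    - exact: (integrableD mI (integrableZl mI (K * (y - x)) (integrable_norm gI))
        (integrable_on_cst x y (K * J))).
    move=> t txy; apply: le_trans (ler_normD _ _) _.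
    have := txy; rewrite /= in_itv/= => /andP[xt ty].
    apply: lerD; rewrite normrM mulrC.
      apply: ler_wpM2r => //; apply: le_trans (lipE _ _) _.
      by rewrite ger0_norm ?subr_ge0// ler_wpM2l// lerD2l lerN2.
    by apply: ler_pM => //; exact: psiJ.
  rewrite /lint_on RintegralD//; last 2 first.
  - exact: (integrableZl mI (K * (y - x)) (integrable_norm gI)).
  - exact: integrable_on_cst.
  rewrite RintegralZl//; last exact: integrable_norm.
  rewrite -!/(lint_on _ _) lint_on_cst// -/J; lra.
have dF (x : R) : is_derive x (1 : R) F 0.
  have Fle' z s : 0 < s -> `|F z - F x| <= 2 * K * `|z - x| * (s * `|z - x| + B / s).
    move=> s0; have [xz|/ltW zx] := leP x z.
      by rewrite (@ger0_norm _ (z - x)) ?subr_ge0//; exact: Fle.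
    rewrite distrC (distrC z) (@ger0_norm _ (x - z)) ?subr_ge0//; exact: Fle.
  apply/is_derive1_caratheodory.
  exists (fun z => (F z - F x) / (z - x)); split.
  - move=> z; have [->|zx] := eqVneq z x; first by rewrite !subrr mulr0.
    by rewrite divfK// subr_eq0.
  - suff : (F z - F x) / (z - x) @[z --> x] --> 0.
      have E : (F x - F x) / (x - x) = 0 by rewrite subrr mul0r.
      by rewrite /prop_for /continuous_at E.
    apply/cvgrPdist_le => e e0.
    pose s := (4 * K * B + 1) / e.
    have KB0 : 0 <= K * B by exact: mulr_ge0.
    have s0 : 0 < s by rewrite divr_gt0//; lra.
    have Ks0 : 0 <= 4 * K * s by apply: mulr_ge0; [exact: mulr_ge0|exact: ltW].
    have d0 : 0 < e / (4 * K * s + 1).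
      by apply: divr_gt0 => //; lra.
    near=> z.
    have zd : `|z - x| <= e / (4 * K * s + 1).
      by rewrite distrC; near: z; exact: (@cvgr_dist_le _ _ _ _ _ id x (@cvg_id _ _)).
    rewrite sub0r normrN normrM normfV.
    have [->|zx] := eqVneq z x; first by rewrite subrr normr0 mul0r ltW.
    rewrite ler_pdivrMr ?normr_gt0 ?subr_eq0//.
    apply: le_trans (Fle' z s s0) _.
    have [h0 hs] : 0 <= `|z - x| /\ 4 * (K * s) * `|z - x| + `|z - x| <= e.
      split=> //; move: zd; rewrite ler_pdivlMr; last by lra.
      by move=> zd; apply: le_trans zd; rewrite le_eqVlt; apply/orP; left; apply/eqP; ring.
    have Bs : 4 * (K * (B / s)) <= e.
      rewrite /s invf_div !mulrA ler_pdivrMr; last by lra.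
      by rewrite mulrC; have := ltW e0; nra.
    have -> : 2 * K * `|z - x| * (s * `|z - x| + B / s) =
      (2 * (K * s) * `|z - x| + 2 * (K * (B / s))) * `|z - x| by ring.
    apply: ler_wpM2r => //; lra.
  - by rewrite subrr mul0r.
have F0 x y : F x = F y by exact: is_derive_0_is_cst.
pose a := `|M| + 1.
have Ma : M < `|a| by rewrite /a ger0_norm ?addr_ge0// (le_lt_trans (ler_norm _))// ltrDl.
have := F0 (- a) a; rewrite /F (supp a Ma).1 (supp (- a) _).1 ?normrN//.
rewrite !mulr0 !sub0r => /oppr_inj.
rewrite lint_on0 => [|x /=]; last first.
  rewrite in_itv/= => xa; have Mx : M < `|x|.
    have := ler_norm (- x); have := ler_norm M; rewrite normrN /a in xa *; lra.
  by rewrite /f (supp x Mx).1 (supp x Mx).2 !mulr0 addr0.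
rewrite /lint_on Rintegral_mkcond (_ : _ \_ _ = f).
  by rewrite /f RintegralD// => /esym/eqP; rewrite addr_eq0 => /eqP.
apply/funext => x; rewrite patchE; case: ifPn => // /negP xa.
have Mx : M < `|x|.
  have : a <= x by rewrite leNgt; apply/negP => xa'; apply: xa; rewrite inE/= in_itv.
  have := ler_norm x; have := ler_norm M; rewrite /a; lra.
by rewrite /f (supp x Mx).1 (supp x Mx).2 !mulr0 addr0.
Unshelve. all: by end_near.
Qed.

End IntegrationByParts.

(** * Eigenvalue sums *)

Lemma cvg_sum_ord (K : realType) n (f : 'I_n -> nat -> K) (l : 'I_n -> K) :
  (forall i, f i N @[N --> \oo] --> l i) ->
  (\sum_(i < n) f i N) @[N --> \oo] --> \sum_(i < n) l i.
Proof.
elim: n f l => [|n IH] f l fl.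
  by under eq_fun do rewrite big_ord0; rewrite big_ord0; exact: cvg_cst.
under eq_fun do rewrite big_ord_recl; rewrite big_ord_recl.
by apply: cvgD; [exact: fl|apply: IH => i; exact: fl].
Qed.

Section SpectralSums.
Context d (T : measurableType d) (R : realType) (mu : {measure set T -> \bar R}).

Lemma bessel (e : nat -> T -> R) (f : T -> R) N : sqint mu f ->
  (forall k, sqint mu (e k)) -> (forall i j, ip mu (e i) (e j) = (i == j)%:R) ->
  \sum_(k < N) ip mu f (e k) ^+ 2 <= ip mu f f.
Proof.
by move=> sf se on; rewrite -subr_ge0 -(bessel_residual N sf se on) ip_ge0.
Qed.

(* The weight [w k = \sum_j <phi j, e k>^2] is at most 1, so moving it onto the
   lowest [n.+1] eigenvalues can only decrease [\sum_k (lam k - lam n) w k]. *)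
Lemma sum_eigenvalues_le (e : nat -> T -> R) (lam : nat -> R) n
    (phi Tphi : 'I_n.+1 -> T -> R) :
  (forall k, lam k <= lam k.+1) ->
  (forall k, sqint mu (e k)) -> (forall i j, ip mu (e i) (e j) = (i == j)%:R) ->
  (forall h, sqint mu h -> (forall k, ip mu h (e k) = 0) -> {ae mu, forall x, h x = 0}) ->
  (forall j, sqint mu (phi j)) -> (forall j, sqint mu (Tphi j)) ->
  (forall j k, ip mu (Tphi j) (e k) = lam k * ip mu (phi j) (e k)) ->
  (forall k, \sum_j ip mu (phi j) (e k) ^+ 2 <= 1) ->
  \sum_(k < n.+1) lam k - n.+1%:R * lam n <=
    \sum_j ip mu (Tphi j) (phi j) - lam n * \sum_j ip mu (phi j) (phi j).
Proof.
move=> lamS se on ce sphi sT eig w1.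
have lamle : {homo lam : i j / (i <= j)%N >-> i <= j}.
  by apply: homo_leq => //; exact: le_trans.
pose w k := \sum_j ip mu (phi j) (e k) ^+ 2.
have w0 k : 0 <= w k by apply: sumr_ge0 => j _; exact: sqr_ge0.
have cvgw : (\sum_(k < N) (lam k - lam n) * w k) @[N --> \oo] -->
    \sum_j ip mu (Tphi j) (phi j) - lam n * \sum_j ip mu (phi j) (phi j).
  have -> : (fun N => \sum_(k < N) (lam k - lam n) * w k) =
      (fun N => \sum_j (\sum_(k < N) ip mu (phi j) (e k) * ip mu (Tphi j) (e k))
         - lam n * \sum_j (\sum_(k < N) ip mu (phi j) (e k) * ip mu (phi j) (e k))).
    apply/funext => N; rewrite exchange_big [X in _ = _ - _ * X]exchange_big/=.
    rewrite mulr_sumr -sumrB; apply: eq_bigr => k _.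
    rewrite /w !mulr_sumr -sumrB; apply: eq_bigr => j _.
    by rewrite eig; ring.
  apply: cvgB; first by apply: cvg_sum_ord => j; exact: parseval.
  by apply: cvgMl_tmp; apply: cvg_sum_ord => j; exact: parseval.
apply: (cvgr_to_ge cvgw); near=> N.
have nN : (n.+1 <= N)%N by near: N; exact: nbhs_infty_ge.
rewrite -(subnKC nN) big_split_ord/=.
have -> : \sum_(k < n.+1) lam k - n.+1%:R * lam n = \sum_(k < n.+1) (lam k - lam n).
  by rewrite sumrB sumr_const card_ord mulr_natl.
rewrite -[leLHS]addr0; apply: lerD.
  apply: ler_sum => k _; rewrite -subr_ge0 -[X in _ - X]mulr1 -mulrBr.
  have : lam k <= lam n by apply: lamle; rewrite -ltnS.
  have := w1 k; rewrite -/(w k); nra.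
apply: sumr_ge0 => k _; apply: mulr_ge0 => //.
by rewrite subr_ge0; apply: lamle; rewrite addSn ltnW// ltnS leq_addr.
Unshelve. all: by end_near.
Qed.

End SpectralSums.

(** * Truncated Hermite functions *)

Section TrialFunctions.
Variable R : realType.
Implicit Types (p : {poly R}) (t x u : R).

(* [max(u, 0)^n], written so that continuity is immediate. *)
Definition pospow n u : R := ((u + `|u|) / 2) ^+ n.

Lemma pospow_ge n u : 0 <= u -> pospow n u = u ^+ n.
Proof. by move=> u0; rewrite /pospow ger0_norm//; congr (_ ^+ _); field. Qed.

Lemma pospow_le n u : u <= 0 -> pospow n.+1 u = 0.
Proof. by move=> u0; rewrite /pospow ler0_norm// subrr mul0r expr0n. Qed.

Lemma pospow_ge0 n u : 0 <= pospow n u.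
Proof.
apply: exprn_ge0; apply: divr_ge0 => //.
by have := ler_norm (- u); rewrite normrN; lra.
Qed.

Lemma pospow_le1 n u : u <= 1 -> pospow n u <= 1.
Proof.
move=> u1; case: n => [|n]; first by rewrite /pospow expr0.
have [u0|/ltW u0] := leP u 0; first by rewrite pospow_le.
by rewrite pospow_ge// exprn_ile1.
Qed.

Lemma pospow_continuous n : continuous (pospow n).
Proof.
move=> u; apply: (@continuous_comp _ _ _ (fun u : R => (u + `|u|) / 2) (fun y => y ^+ n)).
  apply: cvgMr_tmp; apply: cvgD; first exact: cvg_id.
  exact: norm_continuous.
exact: exprn_continuous.
Qed.

Lemma is_derive_pospow n u :
  is_derive u (1 : R) (pospow n.+2) (n.+2%:R * pospow n.+1 u).
Proof.
have [u0|u0|->] := ltgtP u 0.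
- rewrite pospow_le ?ltW// mulr0.
  apply: (@near_eq_is_derive _ _ _ (fun=> 0)).
  near=> z; rewrite pospow_le// ltW//; near: z; exact: lt_nbhsl.
- rewrite pospow_ge ?ltW//.
  apply: (@near_eq_is_derive _ R^o R^o (fun z : R => z ^+ n.+2)).
    near=> z; rewrite pospow_ge// ltW//; near: z; exact: lt_nbhsr.
  have := is_derive_poly ('X^(n.+2) : {poly R}) u.
  rewrite (_ : horner 'X^(n.+2) = fun z => z ^+ n.+2); last first.
    by apply/funext => z; rewrite hornerXn.
  by rewrite derivXn hornerMn hornerXn mulr_natl.
- rewrite pospow_le// mulr0; apply/is_derive1_caratheodory.
  exists (fun z => pospow n.+1 z); split.
  + move=> z; rewrite (pospow_le _ (lexx 0)) !subr0.
    have [z0|/ltW z0] := leP z 0; first by rewrite !pospow_le// mul0r.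
    by rewrite !pospow_ge// -exprSr.
  + exact: pospow_continuous.
  + exact: pospow_le.
Unshelve. all: by end_near.
Qed.

Definition cutoff t x := pospow 3 (1 - t * x ^+ 2).
Definition cutoff1 t x := 3 * pospow 2 (1 - t * x ^+ 2) * (- (2 * t * x)).
Definition cutoff2 t x :=
  6 * pospow 1 (1 - t * x ^+ 2) * (2 * t * x) ^+ 2 - 6 * t * pospow 2 (1 - t * x ^+ 2).

Lemma is_derive_cutoff_arg t x :
  is_derive x (1 : R) (fun y => 1 - t * y ^+ 2) (- (2 * t * x)).
Proof.
have dx := is_derive_id x (1 : R).
have h := is_derive_add (is_derive_cst (1 : R) x (1 : R))
  (is_derive_opp (is_derive_mul (is_derive_cst t x (1 : R)) (is_derive_mul dx dx))).
apply: (is_derive_eq h).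
by rewrite /cst/=; ring.
Qed.

Lemma is_derive_cutoff t x : is_derive x (1 : R) (cutoff t) (cutoff1 t x).
Proof.
exact: (is_derive1_comp (is_derive_pospow 1 _) (is_derive_cutoff_arg t x)).
Qed.

Lemma is_derive_cutoff1 t x : is_derive x (1 : R) (cutoff1 t) (cutoff2 t x).
Proof.
have dx := is_derive_id x (1 : R).
have d2 := is_derive1_comp (is_derive_pospow 0 _) (is_derive_cutoff_arg t x).
have h := is_derive_mul (is_derive_mul (is_derive_cst (3 : R) x (1 : R)) d2)
  (is_derive_opp (is_derive_mul (is_derive_cst (2 * t) x (1 : R)) dx)).
apply: (is_derive_eq h).
by rewrite /cst/= /cutoff2; ring.
Qed.

Lemma cutoff_arg_continuous t : continuous (fun x => 1 - t * x ^+ 2).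
Proof. exact: is_derive_continuous (is_derive_cutoff_arg t). Qed.

Lemma pospow_arg_continuous n t : continuous (fun x => pospow n (1 - t * x ^+ 2)).
Proof.
move=> x; apply: (@continuous_comp _ _ _ (fun x => 1 - t * x ^+ 2) (pospow n)).
  exact: cutoff_arg_continuous.
exact: pospow_continuous.
Qed.

Lemma cutoff2_continuous t : continuous (cutoff2 t).
Proof.
move=> x; apply: cvgB; last by apply: cvgMl_tmp; exact: pospow_arg_continuous.
apply: cvgM; first by apply: cvgMl_tmp; exact: pospow_arg_continuous.
apply: (@continuous_comp _ _ _ (fun x => 2 * t * x) (fun y => y ^+ 2)).
  by apply: cvgMl_tmp; exact: cvg_id.
exact: exprn_continuous.
Qed.

Lemma cutoff_supp t x : 0 < t <= 1 -> t^-1 < `|x| ->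
  [/\ cutoff t x = 0, cutoff1 t x = 0 & cutoff2 t x = 0].
Proof.
move=> /andP[t0 t1] tx.
have le0 : 1 - t * x ^+ 2 <= 0.
  rewrite subr_le0 -[x ^+ 2]real_normK ?num_real//.
  have t1' : 1 <= t^-1 by rewrite -invr1 lef_pV2 ?posrE.
  move: tx; rewrite -(ltr_pM2l t0) mulfV ?gt_eqF// => tx.
  have x1 : 1 <= `|x| by nra.
  by nra.
by rewrite /cutoff /cutoff1 /cutoff2 !pospow_le// !(mulr0, mul0r) subr0.
Qed.

Lemma cutoff_bound t x : 0 < t <= 1 ->
  [/\ `|cutoff t x| <= 1, `|cutoff1 t x| <= 6 * `|x| &
      `|cutoff2 t x| <= 24 * x ^+ 2 + 6].
Proof.
move=> /andP[t0 t1].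
have s1 : 1 - t * x ^+ 2 <= 1.
  by rewrite gerBl mulr_ge0// ?sqr_ge0// ltW.
have b n := pospow_le1 n s1.
have b0 n := pospow_ge0 n (1 - t * x ^+ 2).
split.
- by rewrite /cutoff ger0_norm.
- have -> : `|cutoff1 t x| = 6 * (pospow 2 (1 - t * x ^+ 2) * t) * `|x|.
    rewrite /cutoff1; have := b0 2%N; move: (pospow _ _) => a a0.
    rewrite normrM normrN !normrM (ger0_norm a0) (ger0_norm (ltW t0)).
    by rewrite !normr_nat; ring.
  apply: ler_wpM2r => //.
  have := b 2%N; have := b0 2%N; move: (pospow _ _) => a a0 a1; nra.
- apply: le_trans (ler_normB _ _) _; apply: lerD.
    have -> : `|6 * pospow 1 (1 - t * x ^+ 2) * (2 * t * x) ^+ 2| =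
        24 * (pospow 1 (1 - t * x ^+ 2) * t ^+ 2) * x ^+ 2.
      rewrite ger0_norm; first ring.
      by apply: mulr_ge0; [exact: mulr_ge0|exact: sqr_ge0].
    apply: ler_wpM2r; first exact: sqr_ge0.
    have t2 : t ^+ 2 <= 1 by rewrite exprn_ile1// ltW.
    have := sqr_ge0 t; have := b 1%N; have := b0 1%N.
    move: (pospow _ _) (t ^+ 2) t2 => a z z1 a0 a1 z0; nra.
  have -> : `|6 * t * pospow 2 (1 - t * x ^+ 2)| = 6 * (pospow 2 (1 - t * x ^+ 2) * t).
    rewrite ger0_norm; first ring.
    by apply: mulr_ge0 => //; apply: mulr_ge0 => //; exact: ltW.
  have := b 2%N; have := b0 2%N; move: (pospow _ _) => a a0 a1; nra.
Qed.

Lemma cutoff_cvg (tt : nat -> R) x : tt n @[n --> \oo] --> (0 : R) ->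
  [/\ cutoff (tt n) x @[n --> \oo] --> (1 : R),
      cutoff1 (tt n) x @[n --> \oo] --> (0 : R) &
      cutoff2 (tt n) x @[n --> \oo] --> (0 : R)].
Proof.
move=> t0.
have h k : pospow k (1 - tt n * x ^+ 2) @[n --> \oo] --> (1 : R).
  have arg : (1 - tt n * x ^+ 2) @[n --> \oo] --> (1 : R).
    rewrite -[X in _ --> X]subr0 -[X in _ --> _ - X](mul0r (x ^+ 2)).
    by apply: cvgB; [exact: cvg_cst|exact: cvgMr_tmp].
  have := cvg_comp _ _ arg (@pospow_continuous k 1).
  by rewrite pospow_ge// expr1n.
have l2 : (2 * tt n * x) @[n --> \oo] --> (0 : R).
  have := cvgMr_tmp (b := x) (cvgMl_tmp (a := 2 : R) t0).
  by rewrite mulr0 mul0r; apply.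
have hc k (c : R) : (c * pospow k (1 - tt n * x ^+ 2)) @[n --> \oo] --> c.
  by have := cvgMl_tmp (a := c) (h k); rewrite mulr1; apply.
split; first exact: h.
- by have := cvgM (hc 2%N 3) (cvgN l2); rewrite oppr0 mulr0; apply.
- have := cvgB (cvgM (hc 1%N 6) (cvgM l2 l2)) (cvgM (cvgMl_tmp (a := 6 : R) t0) (h 2%N)).
  by rewrite !mulr0 mul0r subr0; apply.
Qed.

Definition gs x := expR (- (x ^+ 2 / 2)).
Definition gderiv p := p^`() - 'X * p.
Definition pgs p x := p.[x] * gs x.

Lemma is_derive_pgs p x : is_derive x (1 : R) (pgs p) (pgs (gderiv p) x).
Proof.
have E y : gs y = expR (- 2^-1 * y ^+ 2) by rewrite /gs; congr expR; ring.
have := is_derive_expR_scaled_sq (- 2^-1) x; under eq_fun do rewrite -E.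
move=> dg; apply: (is_derive_eq (is_derive_mul (is_derive_poly p x) dg)).
by rewrite -E /pgs /gderiv hornerD hornerN hornerM hornerX; field.
Qed.

Lemma pgsM p q x : pgs p x * pgs q x = (p * q).[x] * expR (- x ^+ 2).
Proof. by rewrite -expR_half_sq hornerM /pgs /gs; ring. Qed.

Lemma pgs_continuous p : continuous (pgs p).
Proof. exact: is_derive_continuous (is_derive_pgs p). Qed.

Definition trial t p x := cutoff t x * pgs p x.
Definition trial1 t p x := cutoff1 t x * pgs p x + cutoff t x * pgs (gderiv p) x.
Definition trial2 t p x :=
  cutoff2 t x * pgs p x + 2 * (cutoff1 t x * pgs (gderiv p) x) +
  cutoff t x * pgs (gderiv (gderiv p)) x.

Lemma is_derive_trial t p x : is_derive x (1 : R) (trial t p) (trial1 t p x).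
Proof. exact: (is_derive_mul (is_derive_cutoff t x) (is_derive_pgs p x)). Qed.

Lemma is_derive_trial1 t p x : is_derive x (1 : R) (trial1 t p) (trial2 t p x).
Proof.
apply: (is_derive_eq (is_derive_add
  (is_derive_mul (is_derive_cutoff1 t x) (is_derive_pgs p x))
  (is_derive_mul (is_derive_cutoff t x) (is_derive_pgs (gderiv p) x)))).
rewrite /trial2; ring.
Qed.

Lemma trial2_continuous t p : continuous (trial2 t p).
Proof.
have c0 := is_derive_continuous (is_derive_cutoff t).
have c1 := is_derive_continuous (is_derive_cutoff1 t).
move=> x; apply: cvgD; last by apply: cvgM; [exact: c0|exact: pgs_continuous].
apply: cvgD; first by apply: cvgM; [exact: cutoff2_continuous|exact: pgs_continuous].
by apply: cvgMl_tmp; apply: cvgM; [exact: c1|exact: pgs_continuous].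
Qed.

Lemma trial_supp t p x : 0 < t <= 1 -> t^-1 < `|x| ->
  [/\ trial t p x = 0, trial1 t p x = 0 & trial2 t p x = 0].
Proof.
move=> t01 tx; have [c0 c1 c2] := cutoff_supp t01 tx.
by rewrite /trial /trial1 /trial2 c0 c1 c2 !mul0r !mulr0 !addr0.
Qed.

Lemma trial_test_fun t p : 0 < t <= 1 -> test_fun (trial t p).
Proof.
move=> t01; split; first by move=> x; have [] := is_derive_trial t p x.
split; last by exists t^-1 => x tx; have [] := trial_supp p t01 tx.
have -> : derive1 (trial t p) = trial1 t p.
  by apply/funext => x; rewrite derive1E; have [_ ->] := is_derive_trial t p x.
exact: is_derive_continuous (is_derive_trial1 t p).
Qed.

Lemma L2_continuous_compact_support (f : R -> R) (M : R) : continuous f ->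
  (forall x, M < `|x| -> f x = 0) -> L2 f.
Proof.
move=> cf f0; have [K _ fK] := compact_support_bounded cf f0.
exact: (sqint_compact_support (continuous_leb_measurable cf) f0 fK).
Qed.

Definition schrodinger_trial (V : R -> R) t p x := - trial2 t p x + V x * trial t p x.

Section Potential.
Variable V : R -> R.
Hypothesis mV : leb_measurable V.
Hypothesis V2 : leb_integrable (fun x => V x ^+ 2 * expR (- x ^+ 2)).

Lemma L2_potential_trial t p : 0 < t <= 1 -> L2 (fun x => V x * trial t p x).
Proof.
move=> t01.
have mtr : leb_measurable (trial t p).
  exact: continuous_leb_measurable (is_derive_continuous (is_derive_trial t p)).
split; first exact: measurable_funM.
have cq : continuous (fun x => cutoff t x * p.[x]).
  move=> x; apply: cvgM; last exact: continuous_horner.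
  exact: (is_derive_continuous (is_derive_cutoff t)).
have q0 x : t^-1 < `|x| -> cutoff t x * p.[x] = 0.
  by move=> tx; have [-> _ _] := cutoff_supp t01 tx; rewrite mul0r.
have [K K0 qK] := compact_support_bounded cq q0.
apply: (Rintegrable_le _ (RintegrableZ (K ^+ 2) V2)).
  by apply: measurable_funX; exact: measurable_funM.
move=> x; rewrite ger0_norm ?sqr_ge0//.
have -> : (V x * trial t p x) ^+ 2 =
    (cutoff t x * p.[x]) ^+ 2 * (V x ^+ 2 * expR (- x ^+ 2)).
  by rewrite -expR_half_sq /trial /pgs /gs; ring.
apply: ler_wpM2r; first by rewrite mulr_ge0 ?sqr_ge0 ?expR_ge0.
by rewrite -[X in X <= _]real_normK ?num_real// lerXn2r ?nnegrE.
Qed.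

Lemma L2_trial t p : 0 < t <= 1 -> L2 (trial t p).
Proof.
move=> t01; apply: (L2_continuous_compact_support (M := t^-1)).
  exact: is_derive_continuous (is_derive_trial t p).
by move=> x tx; have [] := trial_supp p t01 tx.
Qed.

Lemma L2_trial2 t p : 0 < t <= 1 -> L2 (trial2 t p).
Proof.
move=> t01; apply: (L2_continuous_compact_support (M := t^-1)).
  exact: trial2_continuous.
by move=> x tx; have [] := trial_supp p t01 tx.
Qed.

Lemma L2_schrodinger_trial t p : 0 < t <= 1 -> L2 (schrodinger_trial V t p).
Proof.
move=> t01.
have := sqintB (L2_potential_trial p t01) (L2_trial2 p t01).
rewrite (_ : (fun x => _ - _) = schrodinger_trial V t p)//.
by apply/funext => x; rewrite /schrodinger_trial addrC.
Qed.

Lemma schrodinger_trial_eigenfun (lam : R) (psi : R -> R) t p : 0 < t <= 1 ->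
  L2 psi -> schrodinger_eigenfun V lam psi ->
  ip (leb R) (schrodinger_trial V t p) psi = lam * ip (leb R) (trial t p) psi.
Proof.
move=> t01 Lpsi [g [wd [_ eig]]].
have := eig _ (trial_test_fun p t01).
have -> : derive1 (trial t p) = trial1 t p.
  by apply/funext => x; rewrite derive1E; have [_ ->] := is_derive_trial t p x.
rewrite (weak_deriv_by_parts (M := t^-1) wd (is_derive_trial1 t p)); last 2 first.
- exact: trial2_continuous.
- by move=> x tx; have [_ -> ->] := trial_supp p t01 tx.
have -> : lint (fun x => psi x * trial t p x) = ip (leb R) (trial t p) psi by rewrite ipC.
move=> <-.
have -> : lint (fun x => V x * psi x * trial t p x) =
    ip (leb R) psi (fun x => V x * trial t p x).
  by apply: eq_Rintegral => x _; rewrite mulrA (mulrC (psi x)).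
rewrite addrC -[lint _]/(ip (leb R) psi (trial2 t p)) -ipBr//.
- rewrite ipC; congr (ip _ _ _); apply/funext => x.
  by rewrite /schrodinger_trial addrC.
- exact: L2_potential_trial.
- exact: L2_trial2.
Qed.

End Potential.

End TrialFunctions.

(** * Energies of the Hermite functions *)

Section HermiteEnergies.
Variable R : realType.
Implicit Types (p q : {poly R}) (j k n : nat).

Definition hnorm j : R := Num.sqrt pi * 2 ^+ j * j`!%:R.

Lemma hnorm_gt0 j : 0 < hnorm j.
Proof.
by rewrite !mulr_gt0 ?sqrtr_gt0 ?pi_gt0 ?exprn_gt0 ?ltr0n ?fact_gt0.
Qed.

Lemma hnormS j : hnorm j.+1 = 2 * j.+1%:R * hnorm j.
Proof. by rewrite /hnorm exprS factS natrM; ring. Qed.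

Definition hpoly_unit j : {poly R} := (Num.sqrt (hnorm j))^-1%:P * hpoly R j.

Lemma hpoly_unitM i j :
  hpoly_unit i * hpoly_unit j =
  ((Num.sqrt (hnorm i))^-1 * (Num.sqrt (hnorm j))^-1)%:P * (hpoly R i * hpoly R j).
Proof. by rewrite /hpoly_unit polyCM; ring. Qed.

Lemma sqrt_hnormV j : (Num.sqrt (hnorm j))^-1 * (Num.sqrt (hnorm j))^-1 = (hnorm j)^-1.
Proof. by rewrite -invfM -expr2 sqr_sqrtr// ltW// hnorm_gt0. Qed.

Lemma gint_hpoly_unit i j : gint (hpoly_unit i * hpoly_unit j) = (i == j)%:R.
Proof.
rewrite hpoly_unitM gintZ gint_hpoly_orthogonal.
have [->|ij] := eqVneq i j; last by rewrite mul0r mulr0.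
by rewrite mul1r sqrt_hnormV mulVf// gt_eqF// hnorm_gt0.
Qed.

Lemma gint_gderiv p q : gint (gderiv p * q) = - gint (p * gderiv q).
Proof.
apply/eqP; rewrite -addr_eq0 -gintD; apply/eqP.
have <- := gint_raise (- (p * q)).
by congr gint; rewrite derivN derivM /gderiv; ring.
Qed.

Lemma gint_gderiv2_hpoly j :
  gint (gderiv (gderiv (hpoly R j)) * hpoly R j) = - ((j%:R + 2^-1) * hnorm j).
Proof.
rewrite gint_gderiv; congr (- _).
have E : 4%:R * (gderiv (hpoly R j) * gderiv (hpoly R j)) =
    (4 * j * j)%:R * (hpoly R j.-1 * hpoly R j.-1)
    + (hpoly R j.+1 * hpoly R j.+1 - (4 * j)%:R * (hpoly R j.-1 * hpoly R j.+1)).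
  have -> : gderiv (hpoly R j) = (hpoly R j)^`() - 'X * hpoly R j by [].
  by rewrite (hpoly_raise R j) deriv_hpoly !natrM; ring.
have : 4 * gint (gderiv (hpoly R j) * gderiv (hpoly R j)) = (4 * j%:R + 2) * hnorm j.
  rewrite -gint_natl E !gintD gintN !gint_natl !gint_hpoly_orthogonal -!/(hnorm _) !eqxx.
  rewrite (_ : (j.-1 == j.+1) = false); last by apply/eqP; lia.
  rewrite mul0r mulr0 subr0 !mul1r hnormS !natrM.
  case: j {E} => [|j]; first by rewrite !mulr0 mul0r; ring.
  by rewrite /= hnormS -[j.+2]addn1 natrD; ring.
lra.
Qed.

Lemma gint_gderiv2_hpoly_unit j :
  gint (gderiv (gderiv (hpoly_unit j)) * hpoly_unit j) = - (j%:R + 2^-1).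
Proof.
have E p (c : R) : gderiv (c%:P * p) = c%:P * gderiv p.
  by rewrite /gderiv derivM derivC; ring.
rewrite /hpoly_unit !E mulrACA -polyCM gintZ gint_gderiv2_hpoly sqrt_hnormV.
by rewrite mulrN mulrCA mulVf ?mulr1// gt_eqF// hnorm_gt0.
Qed.

Lemma L2_pgs p : L2 (pgs p).
Proof.
split; first exact: continuous_leb_measurable (@pgs_continuous R p).
have := integrable_poly_gauss (p * p).
rewrite (_ : (fun x => _) = (fun x => pgs p x ^+ 2))//.
by apply/funext => x; rewrite -pgsM expr2.
Qed.

Lemma ip_pgs p q : ip (leb R) (pgs p) (pgs q) = gint (p * q).
Proof. by apply: eq_Rintegral => x _; rewrite pgsM. Qed.

Lemma sum_bin_hockey (a : nat -> R) n :
  \sum_(j < n.+1) \sum_(k < j.+1) 'C(j, k)%:R * a k = \sum_(k < n.+1) 'C(n.+1, k.+1)%:R * a k.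
Proof.
elim: n => [|n IH]; first by rewrite !big_ord1.
rewrite big_ord_recr/= IH [RHS]big_ord_recr/= [X in _ + X = _]big_ord_recr/= !binn addrA -big_split/=.
by congr (_ + _); apply: eq_bigr => k _; rewrite (binS n.+1) natrD mulrDl.
Qed.

Lemma sum_half_integers n : \sum_(j < n) (j%:R + 2^-1) = 2^-1 * n%:R ^+ 2 :> R.
Proof.
elim: n => [|n IH]; first by rewrite big_ord0 expr0n mulr0.
by rewrite big_ord_recr/= IH -natr1; field.
Qed.

Section Potential.
Variable V : R -> R.
Hypothesis mV : leb_measurable V.
Hypothesis V2 : leb_integrable (fun x => V x ^+ 2 * expR (- x ^+ 2)).

Lemma integrable_potential_poly p :
  leb_integrable (fun x => V x * p.[x] * expR (- x ^+ 2)).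
Proof.
have LV : L2 (fun x => V x * gs x).
  split.
    apply: measurable_funM => //; have := sqint_measurable (L2_pgs 1).
    by rewrite (_ : pgs 1 = gs (R := R))//; apply/funext => x; rewrite /pgs hornerE mul1r.
  rewrite (_ : (fun x => _) = (fun x => V x ^+ 2 * expR (- x ^+ 2)))//.
  by apply/funext => x; rewrite -expR_half_sq /gs; ring.
have := sqint_mul LV (L2_pgs p).
rewrite (_ : (fun x => _) = (fun x => V x * p.[x] * expR (- x ^+ 2)))//.
by apply/funext => x; rewrite -expR_half_sq /pgs /gs; ring.
Qed.

Definition vint p := lint (fun x => V x * p.[x] * expR (- x ^+ 2)).

Lemma vintD p q : vint (p + q) = vint p + vint q.
Proof.
rewrite /vint/lint; under eq_Rintegral do rewrite hornerD mulrDr mulrDl.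
by rewrite RintegralD//; exact: integrable_potential_poly.
Qed.

Lemma vintZ (c : R) p : vint (c%:P * p) = c * vint p.
Proof.
rewrite /vint/lint; under eq_Rintegral do rewrite hornerM hornerC mulrCA -mulrA.
by rewrite RintegralZl//; exact: integrable_potential_poly.
Qed.

Lemma vint_sum n (F : 'I_n -> {poly R}) :
  vint (\sum_(i < n) F i) = \sum_(i < n) vint (F i).
Proof.
apply: (big_morph vint vintD).
by have := vintZ 0 0; rewrite mulr0 mul0r.
Qed.

Lemma vint_hpoly k : vint (hpoly R k) = hnorm k * hermite_coef V k.
Proof.
rewrite /hermite_coef mulVKf ?gt_eqF ?hnorm_gt0//.
by apply: eq_Rintegral => x _; rewrite horner_hpoly.
Qed.

Lemma vint_hpoly_unit j : vint (hpoly_unit j * hpoly_unit j) =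
  \sum_(k < j.+1) 'C(j, k)%:R * (2 ^+ k * (k.*2)`!%:R / k`!%:R * hermite_coef V k.*2).
Proof.
rewrite hpoly_unitM vintZ sqrt_hnormV hpoly_linearization vint_sum mulr_sumr.
rewrite (reindex_inj rev_ord_inj)/=; apply: eq_bigr => k _.
have kj : (k <= j)%N by rewrite -ltnS.
rewrite subSS -polyC_natr vintZ.
have -> : (j + j - (j - k).*2 = k.*2)%N by lia.
rewrite vint_hpoly bin_sub// !natrM natrX /hnorm.
have pi0 : Num.sqrt pi != 0 :> R by rewrite gt_eqF// sqrtr_gt0 pi_gt0.
have f0 m : m`!%:R != 0 :> R by rewrite pnatr_eq0 -lt0n fact_gt0.
have t0 m : 2 ^+ m != 0 :> R by rewrite expf_neq0.
have -> : j`!%:R = (j ^_ (j - k))%:R * k`!%:R :> R.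
  by rewrite -natrM -[in k`!](subKn kj) ffact_fact// leq_subr.
have -> : 2 ^+ j = 2 ^+ (j - k) * 2 ^+ k :> R by rewrite -exprD subnK.
have -> : 2 ^+ k.*2 = 2 ^+ k * 2 ^+ k :> R by rewrite -exprD addnn.
have g0 : (j ^_ (j - k))%:R != 0 :> R by rewrite pnatr_eq0 -lt0n ffact_gt0 leq_subr.
by field; rewrite pi0 g0 f0 !t0.
Qed.

Lemma energy_trial_cvg (tt : nat -> R) p :
  (forall m, 0 < tt m <= 1) -> tt m @[m --> \oo] --> (0 : R) ->
  ip (leb R) (schrodinger_trial V (tt m) p) (trial (tt m) p) @[m --> \oo] -->
  vint (p * p) - gint (gderiv (gderiv p) * p).
Proof.
move=> t01 t0.
pose p1 := gderiv p; pose p2 := gderiv p1.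
pose r : {poly R} := 24%:P * 'X^2 + 6%:P.
pose F m x := schrodinger_trial V (tt m) p x * trial (tt m) p x.
pose f x := V x * (p * p).[x] * expR (- x ^+ 2) - (p2 * p).[x] * expR (- x ^+ 2).
pose G x := `|(r * p * p).[x] * expR (- x ^+ 2)|
  + `|(12%:P * 'X * p1 * p).[x] * expR (- x ^+ 2)|
  + `|(p2 * p).[x] * expR (- x ^+ 2)|
  + `|V x * (p * p).[x] * expR (- x ^+ 2)|.
have Gi : Rintegrable (leb R) G.
  apply: RintegrableD; last exact/integrable_norm/integrable_potential_poly.
  apply: RintegrableD; last exact/integrable_norm/integrable_poly_gauss.
  by apply: RintegrableD; exact/integrable_norm/integrable_poly_gauss.
have [|||_ cv] := @Rintegral_dominated_cvg _ _ _ (leb R) F f G _ _ Gi.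
- move=> m; apply: measurable_funM; apply: sqint_measurable.
    exact: L2_schrodinger_trial.
  exact: L2_trial.
- move=> x; have [c0 c1 c2] := cutoff_cvg x t0.
  have trc q : cutoff (tt m) x * pgs q x @[m --> \oo] --> pgs q x.
    by have := cvgMr_tmp (b := pgs q x) c0; rewrite mul1r; apply.
  have l0 : cutoff2 (tt m) x * pgs p x @[m --> \oo] --> (0 : R).
    by have := cvgMr_tmp (b := pgs p x) c2; rewrite mul0r; apply.
  have l1 : 2 * (cutoff1 (tt m) x * pgs p1 x) @[m --> \oo] --> (0 : R).
    by have := cvgMl_tmp (a := 2 : R) (cvgMr_tmp (b := pgs p1 x) c1); rewrite mul0r mulr0; apply.
  have := cvgM (cvgD (cvgN (cvgD (cvgD l0 l1) (trc p2))) (cvgMl_tmp (a := V x) (trc p))) (trc p).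
  rewrite addr0 add0r (_ : _ * _ = f x); first by apply.
  by rewrite mulrDl mulNr pgsM -mulrA pgsM /f mulrA addrC.
- move=> m x; have [b0 b1 b2] := cutoff_bound x (t01 m).
  rewrite /F /schrodinger_trial /trial2 /trial /G.
  rewrite -!pgsM -[V x * _ * _]mulrA -pgsM.
  have -> : pgs (r * p) x = (24 * x ^+ 2 + 6) * pgs p x.
    by rewrite /pgs /r hornerM hornerD hornerM !hornerC hornerXn; ring.
  have -> : pgs (12%:P * 'X * p1) x = 12 * x * pgs p1 x.
    by rewrite /pgs !hornerM hornerC hornerX; ring.
  rewrite -/p1 -/p2.
  move: (pgs p x) (pgs p1 x) (pgs p2 x) (cutoff _ x) (cutoff1 _ x) (cutoff2 _ x) b0 b1 b2
    => u u1 u2 h h1 h2 b0 b1 b2.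
  have E : (- (h2 * u + 2 * (h1 * u1) + h * u2) + V x * (h * u)) * (h * u) =
    h * (- (h2 * u * u) - (2 * h1) * (u1 * u) - h * (u2 * u) + h * (V x * (u * u))) by ring.
  rewrite E normrM.
  apply: (@le_trans _ _ `|- (h2 * u * u) - (2 * h1) * (u1 * u) - h * (u2 * u) + h * (V x * (u * u))|).
    by apply: ler_piMl.
  apply: le_trans (ler_normD _ _) _; apply: lerD; last first.
    by rewrite normrM; apply: ler_piMl.
  apply: le_trans (ler_normB _ _) _; apply: lerD; last first.
    by rewrite normrM; apply: ler_piMl.
  apply: le_trans (ler_normB _ _) _; apply: lerD.
    rewrite normrN -!mulrA normrM [leRHS]normrM; apply: ler_wpM2r => //.
    by apply: (le_trans b2); exact: ler_norm.
  have -> : `|2 * h1 * (u1 * u)| = 2 * `|h1| * `|u1 * u|.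
    by rewrite [LHS]normrM (normrM 2) normr_nat.
  have -> : `|12 * x * u1 * u| = 12 * `|x| * `|u1 * u|.
    by rewrite -mulrA [LHS]normrM (normrM 12) normr_nat.
  by apply: ler_wpM2r => //; lra.
move: cv; rewrite (_ : \int[leb R]_x f x = vint (p * p) - gint (p2 * p)); first by apply.
by rewrite RintegralB//; [exact: integrable_potential_poly|exact: integrable_poly_gauss].
Qed.

End Potential.

Lemma norm_trial_cvg (tt : nat -> R) p :
  (forall m, 0 < tt m <= 1) -> tt m @[m --> \oo] --> (0 : R) ->
  ip (leb R) (trial (tt m) p) (trial (tt m) p) @[m --> \oo] --> gint (p * p).
Proof.
move=> t01 t0.
have [||||_ cv] := @Rintegral_dominated_cvg _ _ _ (leb R)
  (fun m x => trial (tt m) p x * trial (tt m) p x)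
  (fun x => (p * p).[x] * expR (- x ^+ 2)) (fun x => `|(p * p).[x] * expR (- x ^+ 2)|).
- by move=> m; apply: measurable_funM; apply: sqint_measurable; exact: L2_trial.
- move=> x; have [c0 _ _] := cutoff_cvg x t0.
  have trc : trial (tt m) p x @[m --> \oo] --> pgs p x.
    by have := cvgMr_tmp (b := pgs p x) c0; rewrite mul1r; apply.
  by rewrite -pgsM; exact: cvgM.
- exact/integrable_norm/integrable_poly_gauss.
- move=> m x; have [b0 _ _] := cutoff_bound x (t01 m).
  rewrite -pgsM /trial; move: (cutoff _ _) b0 => c b0.
  rewrite !normrM mulrACA; apply: ler_piMl; first exact: mulr_ge0.
  exact: mulr_ile1.
exact: cv.
Qed.

Lemma trial_weight_le1 (psi : R -> R) t n : 0 < t <= 1 -> L2 psi ->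
  ip (leb R) psi psi = 1 ->
  \sum_(j < n) ip (leb R) (trial t (hpoly_unit j)) psi ^+ 2 <= 1.
Proof.
move=> t01 Lpsi psi1.
have Lc : L2 (fun x => cutoff t x * psi x).
  apply: (sqint_le _ Lpsi).
    apply: measurable_funM; last exact: Lpsi.1.
    exact: continuous_leb_measurable (is_derive_continuous (is_derive_cutoff t)).
  move=> x; have [b0 _ _] := cutoff_bound x t01.
  by rewrite normrM; apply: ler_piMl.
have on i j : ip (leb R) (pgs (hpoly_unit i)) (pgs (hpoly_unit j)) = (i == j)%:R.
  by rewrite ip_pgs gint_hpoly_unit.
have := bessel n Lc (fun k => L2_pgs (hpoly_unit k)) on.
under eq_bigr => j _.
  rewrite (_ : ip _ _ _ = ip (leb R) (trial t (hpoly_unit j)) psi); last first.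
    by apply: eq_Rintegral => x _; rewrite /trial; ring.
  over.
move=> /le_trans; apply; rewrite -psi1; apply: le_Rintegral => //.
- exact: sqint_mul.
- exact: sqint_mul.
move=> x _; have [b0 _ _] := cutoff_bound x t01.
rewrite mulrACA; apply: ler_piMl; first by rewrite -expr2 sqr_ge0.
by rewrite -expr2 -real_normK ?num_real// exprn_ile1.
Qed.

End HermiteEnergies.

Theorem theorem5p1 (R : realType) (V : R -> R) (lam : nat -> R) :
  leb_measurable V ->
  V x @[x --> +oo] --> +oo ->
  V x @[x --> -oo] --> +oo ->
  leb_integrable (fun x => V x ^+ 2 * expR (- x ^+ 2)) ->
  schrodinger_eigenvalues V lam ->
  forall n : nat,
    \sum_(k < n.+1) lam k <=
      \sum_(k < n.+1)
         (2 ^+ k * ((k.*2)`!)%:R / (k`!)%:R * ('C(n.+1, k.+1))%:R * hermite_coef V k.*2)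
      + 2^-1 * (n.+1)%:R ^+ 2.
Proof.
move=> mV _ _ V2 [lamS [psi [eig [on ce]]]] n.
pose tt m : R := m.+1%:R^-1.
have t01 m : 0 < tt m <= 1 by rewrite invr_gt0 ltr0n/= invf_le1 ?ler1n.
have t0 : tt m @[m --> \oo] --> (0 : R) by exact: cvg_harmonic.
pose q (j : 'I_n.+1) := hpoly_unit R j.
have key m : \sum_(k < n.+1) lam k - n.+1%:R * lam n <=
    \sum_j ip (leb R) (schrodinger_trial V (tt m) (q j)) (trial (tt m) (q j))
    - lam n * \sum_j ip (leb R) (trial (tt m) (q j)) (trial (tt m) (q j)).
  apply: (sum_eigenvalues_le (mu := leb R) (e := psi)) => //.
  - by move=> k; exact: (eig k).1.
  - by move=> j; exact: L2_trial.
  - by move=> j; exact: L2_schrodinger_trial.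
  - by move=> j k; have [Lpsi epsi] := eig k; exact: schrodinger_trial_eigenfun.
  - move=> k; apply: trial_weight_le1 => //; first exact: (eig k).1.
    by rewrite [LHS]on eqxx.
have lim : (\sum_j ip (leb R) (schrodinger_trial V (tt m) (q j)) (trial (tt m) (q j))
    - lam n * \sum_j ip (leb R) (trial (tt m) (q j)) (trial (tt m) (q j))) @[m --> \oo] -->
    \sum_(j < n.+1) (vint V (q j * q j) - gint (gderiv (gderiv (q j)) * q j))
    - lam n * \sum_(j < n.+1) gint (q j * q j).
  apply: cvgB; first by apply: cvg_sum_ord => j; exact: energy_trial_cvg.
  by apply: cvgMl_tmp; apply: cvg_sum_ord => j; exact: norm_trial_cvg.
rewrite -(lerD2r (- (n.+1%:R * lam n))).
apply: le_trans (cvgr_to_ge lim (nearW _ key)) _.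
have -> : \sum_(j < n.+1) gint (q j * q j) = n.+1%:R.
  under eq_bigr do rewrite gint_hpoly_unit eqxx.
  by rewrite sumr_const card_ord.
rewrite (mulrC (lam n)) lerD2r le_eqVlt; apply/orP; left; apply/eqP.
under eq_bigr do rewrite vint_hpoly_unit// gint_gderiv2_hpoly_unit opprK.
rewrite big_split/= sum_half_integers.
congr (_ + _).
rewrite (sum_bin_hockey (fun k => 2 ^+ k * (k.*2)`!%:R / k`!%:R * hermite_coef V k.*2)).
by apply: eq_bigr => k _; ring.
Qed.
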